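(* Let $n\ge 1$ and $0\le \ell\le n/2$. Let $M_j$, $j=1,2$, be the formal Levi-nondegenerate hypersurfaces of signature $\ell$ in $\mathbb{C}^{n+1}$ (at $0$) given, respectively, by $$\operatorname{Im} w=\langle z,\bar z\rangle_\ell+A_j(z,\bar z,w,\bar w),\qquad (z,w)\in\mathbb{C}^n\times\mathbb{C}.$$ Assume that $A_j\in\mathcal{H}_{k_j}$, $j=1,2$, for nonnegative integers $k_1,k_2$ with $k_1+k_2<n$. Then $(M_1,0)$ and $(M_2,0)$ are formally equivalent if and only if there exists $T\in\operatorname{Aut}(\mathbb{H}^{2n+1}_\ell,0)$ sending $M_1$ to $M_2$. More precisely, any formal equivalence sending $(M_1,0)$ to $(M_2,0)$ is the Taylor series of an automorphism $$T(z,w)=\frac{\big(\lambda(z+aw)U,\ \sigma\lambda^2 w\big)}{1-2i\langle z,\bar a\rangle_\ell-(r+i\langle a,\bar a\rangle_\ell)w}\in\operatorname{Aut}(\mathbb{H}^{2n+1}_\ell,0)$$ for some $\lambda>0$, $r\in\mathbb{R}$, $a\in\mathbb{C}^n$, $\sigma=\pm1$ and an invertible $n\times n$ matrix $U$ with $\langle zU,\bar z\bar U\rangle_\ell=\sigma\langle z,\bar z\rangle_\ell$, such that $$A_1\equiv\sigma\lambda^{-2}|q|^2\,A_2\circ(T,\bar T),$$ where $q=q(z,w)=1-2i\langle z,\bar a\rangle_\ell-(r+i\langle a,\bar a\rangle_\ell)w$ is the denominator of $T$, and $A_2\circ(T,\bar T)$ denotes the power series obtained by substituting $T(z,w)$ for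 $(z,w)$ and $\overline{T(z,w)}$ for $(\bar z,\bar w)$ in $A_2$.
   Context: Notation: $\langle a,b\rangle_\ell:=-\sum_{j=1}^{\ell}a_jb_j+\sum_{j=\ell+1}^n a_jb_j$ for $a,b\in\mathbb{C}^n$ (complex bilinear). $\mathbb{H}^{2n+1}_\ell:=\{(z,w)\in\mathbb{C}^n\times\mathbb{C}:\operatorname{Im}w=\langle z,\bar z\rangle_\ell\}$. $\operatorname{Aut}(\mathbb{H}^{2n+1}_\ell,0)$ is the group of germs of local biholomorphisms $(\mathbb{C}^{n+1},0)\to(\mathbb{C}^{n+1},0)$ preserving $\mathbb{H}^{2n+1}_\ell$. Vectors $z\in\mathbb{C}^n$ are rows, so $zU$ is a row vector. Rank and the class $\mathcal{H}_k$: a formal power series $A(Z,\bar Z)$, $Z=(z,w)\in\mathbb{C}^n\times\mathbb{C}$, is real-valued if $A(Z,\bar Z)=\overline{A(Z,\bar Z)}$ formally. Put $V_A:=\operatorname{span}_{\mathbb{C}}\{\frac{\partial^\alpha A}{\partial\bar Z^\alpha}(Z,0):\alpha\in\mathbb{N}^{n+1}\}\subset\mathbb{C}[[Z]]$ and let the rank $\mathrm{R}(A)$ be $\dim_{\mathbb{C}}V_A$ (possibly infinite). For an integer $k\ge0$, $\mathcal{H}_k$ is the set of real-valued formal power series $A(z,\bar z,w,\bar w)$ such that $\mathrm{R}(A)\le k$ and no element of $V_A$ has a constant or linear term; equivalently, $A=\sum_{j=1}^k\phi_j(z,w)\overline{\psi_j(z,w)}$ with $\phi_j,\psi_j\in\mathbb{C}[[z,w]]$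 having no constant or linear terms. Formal objects: a formal hypersurface $M$ at $0$ is given by an equation $\rho(Z,\bar Z)=0$ with $\rho$ a real-valued formal power series without constant term and with nonzero differential at $0$. A formal holomorphic map $H$ with $H(0)=0$ sends $M_1=\{\rho_1=0\}$ to $M_2=\{\rho_2=0\}$ if $\rho_2(H(Z),\overline{H(Z)})$ is a multiple of $\rho_1(Z,\bar Z)$ in the ring of formal power series in $(Z,\bar Z)$. A formal equivalence is a formally invertible holomorphic map $(\mathbb{C}^{n+1},0)\to(\mathbb{C}^{n+1},0)$ sending $M_1$ to $M_2$. *)

(* Defs.v *)
From HB Require Import structures.
From mathcomp Require Import all_boot all_order all_algebra.
From mathcomp Require Import complex.
From mathcomp Require Import all_classical all_reals all_analysis.
(* The notations of mpoly clash with those of mathcomp-analysis. *)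
From mathcomp Require Import -(notations) mpoly.

Set Implicit Arguments.
Unset Strict Implicit.
Unset Printing Implicit Defensive.

Import Order.TTheory GRing.Theory Num.Theory.
Import numFieldNormedType.Exports.

Local Open Scope classical_set_scope.
Local Open Scope ring_scope.

(* Formal power series in m variables: families of coefficients indexed by
   the exponents [multinom m] (written 'X_{1..m} in mpoly). *)
Record fps (K : Type) (m : nat) := FPS { fps_coef :> multinom m -> K }.

HB.instance Definition _ (K : Type) m := gen_eqMixin (fps K m).
HB.instance Definition _ (K : Type) m := gen_choiceMixin (fps K m).

Section FpsRing.
Variables (K : comNzRingType) (m : nat).
Implicit Types (f g h : fps K m) (a : multinom m).

Lemma fpsP f g : (forall a, f a = g a) <-> f = g.
Proof. by split=> [|-> //]; case: f g => f [g] /= fg; congr FPS; apply/funext. Qed.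

Definition fps_zero : fps K m := FPS (fun=> 0).
Definition fps_opp f : fps K m := FPS (fun a => - f a).
Definition fps_add f g : fps K m := FPS (fun a => f a + g a).

Fact fps_addA : associative fps_add.
Proof. by move=> f g h; apply/fpsP => a; rewrite /= addrA. Qed.
Fact fps_addC : commutative fps_add.
Proof. by move=> f g; apply/fpsP => a; rewrite /= addrC. Qed.
Fact fps_add0 : left_id fps_zero fps_add.
Proof. by move=> f; apply/fpsP => a; rewrite /= add0r. Qed.
Fact fps_addN : left_inverse fps_zero fps_opp fps_add.
Proof. by move=> f; apply/fpsP => a; rewrite /= addNr. Qed.

HB.instance Definition _ :=
  GRing.isZmodule.Build (fps K m) fps_addA fps_addC fps_add0 fps_addN.

Definition fps_one : fps K m := FPS (fun a => (a == @mnm0 m)%:R).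

Definition fps_mul f g : fps K m :=
  FPS (fun a => \sum_(k : bmultinom m (mdeg a).+1 * bmultinom m (mdeg a).+1
                      | a == mnm_add k.1 k.2) f k.1 * g k.2).

Local Definition fps_trunc d f : mpoly m K :=
  \sum_(b : bmultinom m d) f b *: @mpolyX m K b.

Local Lemma fps_truncE d f a :
  (mdeg a < d)%N -> mcoeff a (fps_trunc d f) = f a.
Proof. exact: mcoeff_mpoly. Qed.

Local Lemma mcoeffM_eq d (p q p' q' : mpoly m K) a : (mdeg a < d)%N ->
  (forall b, (mdeg b < d)%N -> mcoeff b p = mcoeff b p') ->
  (forall b, (mdeg b < d)%N -> mcoeff b q = mcoeff b q') ->
  mcoeff a (p * q) = mcoeff a (p' * q').
Proof.
move=> ad pp' qq'; rewrite !mcoeffM; apply: eq_bigr => -[b c] _ /=.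
by rewrite pp' ?qq' //; apply: leq_trans ad; apply: bmdeg.
Qed.

Local Lemma fps_mulE d f g a : (mdeg a < d)%N ->
  fps_mul f g a = mcoeff a (fps_trunc d f * fps_trunc d g).
Proof.
move=> ad; rewrite mcoeffM; apply: eq_bigr => -[b c] _ /=.
by rewrite !fps_truncE //; apply: leq_trans ad; apply: bmdeg.
Qed.

Fact fps_mulA : associative fps_mul.
Proof.
move=> f g h; apply/fpsP => a; have ad := ltnSn (mdeg a).
rewrite !(fps_mulE _ _ ad); set T := fps_trunc _.
transitivity (mcoeff a (T f * (T g * T h))).
  by apply: (mcoeffM_eq ad) => // b bd; rewrite fps_truncE // (fps_mulE _ _ bd).
rewrite mulrA; apply: (mcoeffM_eq ad) => // b bd.
by rewrite fps_truncE // (fps_mulE _ _ bd).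
Qed.

Fact fps_mulC : commutative fps_mul.
Proof.
by move=> f g; apply/fpsP => a; rewrite !(fps_mulE _ _ (ltnSn (mdeg a))) mulrC.
Qed.

Fact fps_mul1 : left_id fps_one fps_mul.
Proof.
move=> f; apply/fpsP => a; have ad := ltnSn (mdeg a).
rewrite (fps_mulE _ _ ad) -[RHS](fps_truncE f ad) -[in RHS](mul1r (fps_trunc _ f)).
by apply: mcoeffM_eq ad _ _ => // b bd; rewrite fps_truncE // mcoeff1.
Qed.

Fact fps_mulDl : left_distributive fps_mul +%R.
Proof.
move=> f g h; apply/fpsP => a; rewrite /= -big_split /=.
by apply: eq_bigr => k _; rewrite mulrDl.
Qed.

Fact fps_one_neq0 : fps_one != 0.
Proof.
by apply/eqP => /fpsP /(_ (@mnm0 m)) /= /eqP; rewrite eqxx oner_eq0.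
Qed.

HB.instance Definition _ := GRing.Zmodule_isComNzRing.Build (fps K m)
  fps_mulA fps_mulC fps_mul1 fps_mulDl fps_one_neq0.

Definition fps_scale (c : K) f : fps K m := FPS (fun a => c * f a).

Fact fps_scaleA c d f : fps_scale c (fps_scale d f) = fps_scale (c * d) f.
Proof. by apply/fpsP => a; rewrite /= mulrA. Qed.
Fact fps_scale1 : left_id 1 fps_scale.
Proof. by move=> f; apply/fpsP => a; rewrite /= mul1r. Qed.
Fact fps_scaleDr : right_distributive fps_scale +%R.
Proof. by move=> c f g; apply/fpsP => a; rewrite /= mulrDr. Qed.
Fact fps_scaleDl f : {morph fps_scale^~ f : c d / c + d}.
Proof. by move=> c d; apply/fpsP => a; rewrite /= mulrDl. Qed.

HB.instance Definition _ := GRing.Zmodule_isLmodule.Build K (fps K m)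
  fps_scaleA fps_scale1 fps_scaleDr fps_scaleDl.

End FpsRing.

Section FpsOperations.
Variable K : comNzRingType.

Definition fpsX m (i : 'I_m) : fps K m := FPS (fun a => (a == mnm1 i)%:R).

Definition fps_vars m : 'rV[fps K m]_m := \row_i fpsX i.

Definition fps_deriv m (i : 'I_m) (f : fps K m) : fps K m :=
  FPS (fun a => (a i).+1%:R * f (mnm_add a (mnm1 i))).

(* Substitution f(G_1, .., G_m), meant for G without constant terms: G^b then
   has order at least [mdeg b], so that only the exponents b of degree at most
   [mdeg a] contribute to the coefficient of exponent a. *)
Definition fps_comp m p (f : fps K m) (G : 'rV[fps K p]_m) : fps K p :=
  FPS (fun a => \sum_(b : bmultinom m (mdeg a).+1)
                  f b * (\prod_(i < m) G 0 i ^+ (b : multinom m) i) a).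

End FpsOperations.

(* The composite of the a_i-th iterates of the partial derivations D i. *)
Definition multi_deriv (V : Type) m (D : 'I_m -> V -> V) (a : multinom m)
    (x : V) : V :=
  foldr (fun i => iter (a i) (D i)) x (enum 'I_m).

Definition lspan (K : nzRingType) (V : lmodType K) (S : set V) : set V :=
  [set v | exists (p : nat) (c : 'I_p -> K) (g : 'I_p -> V),
     (forall i, S (g i)) /\ v = \sum_i c i *: g i].

(* dim W <= k: no k+1 vectors of the subspace W are linearly independent. *)
Definition dim_le (K : nzRingType) (V : lmodType K) (W : set V) (k : nat) :=
  forall v : 'I_k.+1 -> V, (forall i, W (v i)) ->
  exists c : 'I_k.+1 -> K, (exists i, c i != 0) /\ \sum_i c i *: v i = 0.

Definition zcoord (T : Type) n (Z : 'rV[T]_(n + 1)) : 'rV[T]_n := lsubmx Z.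
Definition wcoord (T : Type) n (Z : 'rV[T]_(n + 1)) : T := rsubmx Z 0 0.

Definition lform (K : pzRingType) n (l : nat) (a b : 'rV[K]_n) : K :=
  - (\sum_(j < n | (j < l)%N) a 0 j * b 0 j)
  + \sum_(j < n | (l <= j)%N) a 0 j * b 0 j.

(* The topology and norm of C = R[i], coming from its structure of
   numFieldType. Differentiability and derivatives over R[i] are complex. *)
HB.instance Definition _ (R : realType) := NormedModule.copy R[i] R[i]^o.

Section Formal.
Variable R : realType.
Local Notation C := R[i].

(* A series A(Z, Zbar), with Z in C^N, is an element of [fps C (N + N)]: the
   first N variables are Z, the last N ones are Zbar. *)
Definition Zvars N : 'rV[fps C (N + N)]_N := lsubmx (fps_vars C (N + N)).
Definition Zbars N : 'rV[fps C (N + N)]_N := rsubmx (fps_vars C (N + N)).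

(* F(Z), as a series in (Z, Zbar). *)
Definition holo N (F : fps C N) : fps C (N + N) := fps_comp F (Zvars N).

(* The formal complex conjugate of A(Z, Zbar): conjugate the coefficients and
   exchange Z and Zbar. *)
Definition fps_conj N (A : fps C (N + N)) : fps C (N + N) :=
  fps_comp (FPS (fun a => (A a)^*)) (row_mx (Zbars N) (Zvars N)).

(* A(H(Z), conj H(Z)). *)
Definition comp_bar N (A : fps C (N + N)) (H : 'rV[fps C N]_N) :
    fps C (N + N) :=
  fps_comp A (row_mx (map_mx (fun F => holo F) H)
                     (map_mx (fun F => fps_conj (holo F)) H)).

(* A(Z, 0). *)
Definition at_Zbar0 N (A : fps C (N + N)) : fps C N :=
  fps_comp A (row_mx (fps_vars C N) 0).

Definition VA N (A : fps C (N + N)) : set (fps C N) :=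
  lspan [set f | exists a : multinom N,
    f = at_Zbar0 (multi_deriv (fun i => fps_deriv (rshift N i)) a A)].

(* Membership in the class H_k. Elements of VA A are series in Z alone. *)
Definition Hclass N (k : nat) (A : fps C (N + N)) : Prop :=
  [/\ fps_conj A = A,
      dim_le (VA A) k &
      forall f, VA A f -> forall a : multinom N, (mdeg a <= 1)%N -> f a = 0].

(* The real-valued series Im w - <z, zbar>_l - A defining the hypersurface. *)
Definition fdefining n (l : nat) (A : fps C ((n + 1) + (n + 1))) :
    fps C ((n + 1) + (n + 1)) :=
  let Z := Zvars (n + 1) in let Zb := Zbars (n + 1) in
  (2 * 'i)^-1 *: (wcoord Z - wcoord Zb) - lform l (zcoord Z) (zcoord Zb) - A.

Definition no_constant_term N (H : 'rV[fps C N]_N) : Prop :=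
  forall i, H 0 i (@mnm0 N) = 0.

Definition formally_invertible N (H : 'rV[fps C N]_N) : Prop :=
  no_constant_term H /\
  exists G : 'rV[fps C N]_N,
    [/\ no_constant_term G,
        map_mx (fun f => fps_comp f H) G = fps_vars C N &
        map_mx (fun f => fps_comp f G) H = fps_vars C N].

(* H sends the formal hypersurface rho1 = 0 to rho2 = 0. *)
Definition sends N (H : 'rV[fps C N]_N) (rho1 rho2 : fps C (N + N)) : Prop :=
  exists g, comp_bar rho2 H = g * rho1.

Definition formal_equivalence N (H : 'rV[fps C N]_N) (rho1 rho2 : fps C (N + N)) :
    Prop :=
  formally_invertible H /\ sends H rho1 rho2.

Definition formally_equivalent N (rho1 rho2 : fps C (N + N)) : Prop :=
  exists H, formal_equivalence H rho1 rho2.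

End Formal.

Section Germs.
Variable R : realType.
Local Notation C := R[i].

(* Meant for f holomorphic near 0, so that the order of the partial
   derivatives is irrelevant. *)
Definition taylor N (f : 'rV[C]_N -> C) : fps C N :=
  FPS (fun a => multi_deriv (fun i g Z => 'D_(delta_mx 0 i) g Z) a f 0
                / (\prod_(i < N) (a i)`!)%:R).

Definition taylor_map N (T : 'rV[C]_N -> 'rV[C]_N) : 'rV[fps C N]_N :=
  \row_i taylor (fun Z => T Z 0 i).

Definition holomorphic_at0 N (T : 'rV[C]_N -> 'rV[C]_N) : Prop :=
  \forall Z \near (0 : 'rV[C]_N), differentiable T Z.

(* T represents the germ of a biholomorphism (C^N, 0) -> (C^N, 0). *)
Definition local_biholomorphism N (T : 'rV[C]_N -> 'rV[C]_N) : Prop :=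
  [/\ T 0 = 0, holomorphic_at0 T &
      exists S : 'rV[C]_N -> 'rV[C]_N,
        [/\ S 0 = 0, holomorphic_at0 S &
            \forall Z \near (0 : 'rV[C]_N), S (T Z) = Z /\ T (S Z) = Z]].

Definition hyperquadric n (l : nat) : set 'rV[C]_(n + 1) :=
  [set Z | 'Im (wcoord Z) = lform l (zcoord Z) (map_mx Num.conj (zcoord Z))].

(* T represents an element of Aut(H_l, 0). *)
Definition aut_hyperquadric n (l : nat) (T : 'rV[C]_(n + 1) -> 'rV[C]_(n + 1)) :
    Prop :=
  local_biholomorphism T /\
  \forall Z \near (0 : 'rV[C]_(n + 1)),
    hyperquadric l (T Z) <-> hyperquadric l Z.

(* q(z, w) = 1 - 2i <z, abar> - (r + i <a, abar>) w *)
Definition aut_den n (l : nat) (r : R) (a : 'rV[C]_n) (Z : 'rV[C]_(n + 1)) : C :=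
  1 - 2 * 'i * lform l (zcoord Z) (map_mx Num.conj a)
    - ((r%:C)%C + 'i * lform l a (map_mx Num.conj a)) * wcoord Z.

(* T(z, w) = (lambda (z + a w) U, sigma lambda^2 w) / q(z, w) *)
Definition aut_map n (l : nat) (lambda r : R) (a : 'rV[C]_n) (sigma : C)
    (U : 'M[C]_n) (Z : 'rV[C]_(n + 1)) : 'rV[C]_(n + 1) :=
  (aut_den l r a Z)^-1 *:
    row_mx ((lambda%:C)%C *: ((zcoord Z + wcoord Z *: a) *m U))
           (sigma * (lambda%:C)%C ^+ 2 * wcoord Z)%:M.

End Germs.

(* Main.v *)
Require Import Defs.
From HB Require Import structures.
From mathcomp Require Import all_boot all_order all_algebra.
From mathcomp Require Import complex.
From mathcomp Require Import all_classical all_reals all_analysis.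
From mathcomp Require Import -(notations) mpoly.
From mathcomp Require Import ring zify.

(** Write H = (f, g), and let G be the factor such that the equation of M2, pulled
    back by H, is G times the equation of M1. The proof regards a series in
    (Z, Zbar) as an infinite matrix, whose rows and columns are indexed by the powers
    of Z and of Zbar. For this matrix, substituting (H, Hbar) and multiplying by
    u(Z) v(Zbar) are matrix products, so neither increases the rank.

    At Zbar = 0 the equation says that g = p w with p(Z) = G(Z, 0)
    (sends_normal_component). Reality then gives G(0, Zbar) = conj(p), and c = p(0) is
    a nonzero real number. Put q = c / p and F = q f, and multiply the equation
    by q qbar / c. The result has the form
      (w qbar - q wbar) / 2i - <F, Fbar> / c - A2'
        = (1 + G') ((w - wbar) / 2i - <z, zbar> - A1),
    where A2' still has rank at most k2, and G' vanishes at Z = 0 and at Zbar = 0.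

    The claim is G' = 0. Give weight 1 to z and 3 to w, and suppose that the part of
    lowest weight of G' has weight m. In the terms linear in Zbar, the equation shows
    that the nonlinear part of F consists of combinations of w times the coefficients
    of G'; so <F, Fbar> is negligible among the terms of weight m + 2 and of degree at
    least 2 in Z and in Zbar. What remains there is G' <z, zbar> = A2' - A1
    (leading_coef). The right side has rank at most k1 + k2 < n, whereas the product
    of a nonzero polynomial with <z, zbar> has rank at least n (huang_submatrix).
    This is a contradiction.

    Once G' = 0, the terms linear in Zbar show that F and q are of degree at most 1,
    so that H = (F, c w) / q is linear fractional, and the remaining terms
    give A1 = A2'. The terms of bidegree (1, 1) say that the linear parts of F and q
    preserve the Hermitian form of the hyperquadric up to c (first_order_isometry),
    which yields the parameters of the automorphism (lf_aut_map). The Taylor series of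
    this automorphism is identified by the product rule for affine factors, which
    determines the series of a quotient of affine functions (taylor_affine_frac).

    Conversely, an automorphism T is a local biholomorphism, its Jacobian at 0 is
    invertible by the chain rule, and the formal inverse function theorem makes its
    Taylor series an invertible formal map. *)

Set Implicit Arguments.
Unset Strict Implicit.
Unset Printing Implicit Defensive.

Import Order.TTheory GRing.Theory Num.Theory.
Import numFieldNormedType.Exports.
Local Open Scope ring_scope.

Local Notation "a +m b" := (mnm_add a b) (at level 50, left associativity).
Local Notation "a -m b" := (mnm_sub a b) (at level 50, left associativity).
Local Notation "a <=m b" := (lem a b) (at level 70).

(* Simplification would replace a coefficient of these series by its defining sum. *)
#[local] Arguments fps_comp : simpl never.
#[local] Arguments fps_mul : simpl never.
#[local] Arguments holo : simpl never.
#[local] Arguments fps_conj : simpl never.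
#[local] Arguments comp_bar : simpl never.
#[local] Arguments at_Zbar0 : simpl never.

(** * Coefficients of products of power series *)

(** Coefficients of products and composites are sums truncated at a degree that
    depends on the coefficient; only the support of the summand matters. *)
Lemma eq_big_supp (T : eqType) (V : nmodType) (s1 s2 : seq T) (F : T -> V) :
  uniq s1 -> uniq s2 -> (forall x, F x != 0 -> (x \in s1) = (x \in s2)) ->
  \sum_(x <- s1) F x = \sum_(x <- s2) F x.
Proof.
move=> u1 u2 s12.
have nz s : \sum_(x <- s) F x = \sum_(x <- [seq y <- s | F y != 0]) F x.
  rewrite (bigID (fun x => F x != 0)) /= [X in _ + X]big1 ?addr0 ?big_filter //.
  by move=> x /negPn/eqP.
rewrite (nz s1) (nz s2); apply: perm_big; apply: uniq_perm; rewrite ?filter_uniq //.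
by move=> x; rewrite !mem_filter; case: (boolP (F x != 0)) => //= /s12.
Qed.

(** A list rather than the finite type of bounded exponents, so that sums with
    different bounds range over the same type. *)
Definition mons m d : seq (multinom m) := [seq val b | b <- enum {: bmultinom m d}].

Lemma mons_uniq m d : uniq (mons m d).
Proof. by rewrite map_inj_uniq ?enum_uniq //; exact: val_inj. Qed.

Lemma mem_mons m d (a : multinom m) : (a \in mons m d) = (mdeg a < d)%N.
Proof.
apply/mapP/idP => [[b _ ->]|ad]; first exact: bmdeg.
by exists (BMultinom ad); rewrite ?mem_enum.
Qed.

Lemma big_mons (V : nmodType) m d (F : multinom m -> V) :
  \sum_(b : bmultinom m d) F b = \sum_(b <- mons m d) F b.
Proof. by rewrite big_map big_enum. Qed.

Section Coefficients.
Variables (K : comNzRingType) (m : nat).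
Implicit Types (f g h : fps K m) (a b c : multinom m).

Lemma fcoefD f g a : (f + g) a = f a + g a. Proof. by []. Qed.
Lemma fcoefB f g a : (f - g) a = f a - g a. Proof. by []. Qed.
Lemma fcoef0 a : (0 : fps K m) a = 0. Proof. by []. Qed.
Lemma fcoefZ k f a : (k *: f) a = k * f a. Proof. by []. Qed.
Lemma fcoef1 a : (1 : fps K m) a = (a == mnm0)%:R. Proof. by []. Qed.

Lemma fcoef_sum I (r : seq I) (P : pred I) (F : I -> fps K m) a :
  (\sum_(i <- r | P i) F i) a = \sum_(i <- r | P i) F i a.
Proof.
exact: (big_morph (fun f : fps K m => f a) (fun f g => fcoefD f g a) (fcoef0 a)).
Qed.

(** Only the divisors b of a contribute, each with the cofactor a - b. *)
Lemma fcoefM f g a (s : seq (multinom m)) : uniq s ->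
  (forall b, b <=m a -> b \in s) ->
  (f * g) a = \sum_(b <- s | b <=m a) f b * g (a -m b).
Proof.
move=> us as_.
transitivity (\sum_(b : bmultinom m (mdeg a).+1)
   (if b <=m a then f b * g (a -m b) else 0)).
  rewrite -[LHS]/(fps_mul f g a) /fps_mul /=.
  rewrite (eq_bigl (fun k : bmultinom m (mdeg a).+1 * bmultinom m (mdeg a).+1 =>
     true && (a == k.1 +m k.2))) //.
  rewrite -(pair_big_dep xpredT (fun b c : bmultinom m (mdeg a).+1 => a == b +m c)
     (fun b c : bmultinom m (mdeg a).+1 => f b * g c)) /=.
  apply: eq_bigr => b _; case: ifPn => [ba|Nba].
    have cd : (mdeg (a -m b) < (mdeg a).+1)%N by rewrite ltnS mdegB.
    rewrite (big_pred1 (BMultinom cd)) //= => c.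
    apply/eqP/eqP => [e|->]; last by rewrite /= addmC (submK ba).
    by apply: val_inj; apply: (addIm (x := b)); rewrite /= (submK ba) addmC -e.
  rewrite big_pred0 // => c; apply: contraNF Nba => /eqP e; by rewrite [X in _ <=m X]e lem_addr.
etransitivity; first exact: (big_mons _ (fun b => if b <=m a then f b * g (a -m b) else 0)).
rewrite [RHS]big_mkcond.
apply: eq_big_supp; rewrite ?mons_uniq // => b.
case: ifP; rewrite ?eqxx // => ba _; rewrite (as_ _ ba) mem_mons ltnS.
by rewrite -(submK ba) mdegD leq_addl.
Qed.

Lemma fcoefM_mons d f g a : (mdeg a < d)%N ->
  (f * g) a = \sum_(b <- mons m d | b <=m a) f b * g (a -m b).
Proof.
move=> ad; apply: fcoefM => [|b ba]; rewrite ?mons_uniq // mem_mons.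
by apply: leq_ltn_trans ad; rewrite -(submK ba) mdegD leq_addl.
Qed.

Lemma fcoefM_eq0 f g a :
  (forall b c, a = b +m c -> f b * g c = 0) -> (f * g) a = 0.
Proof.
move=> fg; rewrite (fcoefM_mons _ _ (ltnSn _)); apply: big1 => b ba.
by apply: fg; rewrite addmC submK.
Qed.

(** For the product of a series in Z with a series in Zbar, or of two monomials,
    a single pair of exponents contributes to each coefficient. *)
Lemma fcoefM_single f g b c :
  (forall b' c', b' != b -> b +m c = b' +m c' -> f b' * g c' = 0) ->
  (f * g) (b +m c) = f b * g c.
Proof.
move=> fg; rewrite (fcoefM_mons _ _ (ltnSn _)) big_mkcond.
rewrite (bigD1_seq b) ?mons_uniq //=; last first.
  by rewrite mem_mons ltnS mdegD leq_addr.
rewrite lem_addr [in g _]addmC addmK big1 ?addr0 // => b' b'b; case: ifP => // ba.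
by apply: fg => //; rewrite [b' +m _]addmC submK.
Qed.

Lemma fps_scalerAl k f g : k *: (f * g) = (k *: f) * g.
Proof.
apply/fpsP => a; rewrite fcoefZ !(fcoefM_mons _ _ (ltnSn _)) mulr_sumr.
by apply: eq_bigr => b _; rewrite mulrA.
Qed.

End Coefficients.

HB.instance Definition _ (K : comNzRingType) m :=
  GRing.Lmodule_isLalgebra.Build K (fps K m) (@fps_scalerAl K m).
HB.instance Definition _ (K : comNzRingType) m :=
  GRing.Lalgebra_isComAlgebra.Build K (fps K m).

(** * Orders and substitution *)

Section Order.
Variables (K : comNzRingType) (m : nat).
Implicit Types (f g h : fps K m) (a b c : multinom m).

Definition order_ge d f := forall a, (mdeg a < d)%N -> f a = 0.

Lemma order_geM d e f g : order_ge d f -> order_ge e g -> order_ge (d + e) (f * g).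
Proof.
move=> df eg a ade; apply: fcoefM_eq0 => b c abc.
have [bd|db] := ltnP (mdeg b) d; first by rewrite df ?mul0r.
rewrite [g c]eg ?mulr0 //; move: ade; rewrite abc mdegD; lia.
Qed.

Lemma order_geX f k : order_ge 1 f -> order_ge k (f ^+ k).
Proof.
move=> f1; elim: k => [|k IH]; first by [].
by rewrite exprS -add1n; apply: order_geM.
Qed.

Lemma order_ge1P f : order_ge 1 f <-> f mnm0 = 0.
Proof.
split=> [->|f0 a]; rewrite ?mdeg0 // ltnS leqn0 mdeg_eq0 => /eqP -> //.
Qed.

End Order.

Section Composition.
Variable K : comNzRingType.

Lemma nct_order N p (G : 'rV[fps K p]_N) :
  (forall i, G 0 i mnm0 = 0) -> forall i, order_ge 1 (G 0 i).
Proof. by move=> G0 i; apply/order_ge1P. Qed.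

Definition mon_subst m p (G : 'rV[fps K p]_m) (b : multinom m) : fps K p :=
  \prod_(i < m) G 0 i ^+ b i.

Variables (m p : nat) (G : 'rV[fps K p]_m).
Hypothesis G0 : forall i, G 0 i mnm0 = 0.
Implicit Types (f g h : fps K m) (a b c : multinom m).

Lemma mon_substD b c : mon_subst G (b +m c) = mon_subst G b * mon_subst G c.
Proof.
rewrite /mon_subst -big_split /=; apply: eq_bigr => i _.
by rewrite mnmDE exprD.
Qed.

Lemma mon_subst0 : mon_subst G mnm0 = 1.
Proof. by apply: big1 => i _; rewrite mnm0E. Qed.

Lemma mon_subst1 i : mon_subst G (mnm1 i) = G 0 i.
Proof.
rewrite /mon_subst (bigD1 i) //= mnm1E eqxx expr1 big1 ?mulr1 // => j ji.
by rewrite mnm1E eq_sym (negPf ji).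
Qed.

(** The reason why substitution makes sense: G^b has order at least |b|, so that
    finitely many b contribute to a given coefficient. *)
Lemma order_mon_subst b : order_ge (mdeg b) (mon_subst G b).
Proof.
rewrite /mon_subst mdegE.
elim/big_rec2: _ => [//|i f k _ kf]; apply: order_geM => //.
by apply: order_geX; apply: nct_order.
Qed.

(** The truncation degree can be raised at will, which allows substitutions to be
    compared coefficientwise with a common truncation. *)
Lemma fcoef_comp d f (a : multinom p) : (mdeg a < d)%N ->
  fps_comp f G a = \sum_(b <- mons m d) f b * mon_subst G b a.
Proof.
move=> ad; rewrite -[LHS]/(\sum_(b : bmultinom m (mdeg a).+1) f b * mon_subst G b a).
etransitivity; first exact: (big_mons _ (fun b => f b * mon_subst G b a)).
apply: eq_big_supp; rewrite ?mons_uniq // => b fb; rewrite !mem_mons.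
have [ba|/(order_mon_subst)/eqP] := leqP (mdeg b) (mdeg a); last first.
  by move=> /eqP b0; rewrite b0 mulr0 eqxx in fb.
by rewrite ltnS ba (leq_ltn_trans ba ad).
Qed.

Lemma comp_coef0 f : fps_comp f G mnm0 = f mnm0.
Proof.
rewrite (fcoef_comp (d := 1)) ?mdeg0 // (bigD1_seq mnm0) ?mons_uniq ?mem_mons ?mdeg0 //=.
rewrite mon_subst0 fcoef1 eqxx mulr1 big_seq_cond big1 ?addr0 // => b.
by rewrite mem_mons ltnS leqn0 mdeg_eq0 andbC; case: eqP.
Qed.

Lemma comp0 : fps_comp 0 G = 0.
Proof.
by apply/fpsP => a; rewrite (fcoef_comp _ (ltnSn _)) big1 // => b _; rewrite mul0r.
Qed.

Lemma compD f g : fps_comp (f + g) G = fps_comp f G + fps_comp g G.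
Proof.
apply/fpsP => a; rewrite fcoefD !(fcoef_comp _ (ltnSn _)) -big_split /=.
by apply: eq_bigr => b _; rewrite mulrDl.
Qed.

Lemma compN f : fps_comp (- f) G = - fps_comp f G.
Proof. by apply/eqP; rewrite -subr_eq0 opprK -compD addNr comp0. Qed.

Lemma compB f g : fps_comp (f - g) G = fps_comp f G - fps_comp g G.
Proof. by rewrite compD compN. Qed.

Lemma compZ k f : fps_comp (k *: f) G = k *: fps_comp f G.
Proof.
apply/fpsP => a; rewrite fcoefZ !(fcoef_comp _ (ltnSn _)) mulr_sumr.
by apply: eq_bigr => b _; rewrite fcoefZ mulrA.
Qed.

Lemma comp_delta f b : (forall c, f c = (c == b)%:R) -> fps_comp f G = mon_subst G b.
Proof.
move=> fE; apply/fpsP => a.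
pose d := maxn (mdeg a).+1 (mdeg b).+1.
rewrite (fcoef_comp (d := d)) ?leq_maxl //.
rewrite (bigD1_seq b) ?mons_uniq ?mem_mons ?leq_maxr //= fE eqxx mul1r.
by rewrite big1 ?addr0 // => c /negPf cb; rewrite fE cb mul0r.
Qed.

Lemma comp1 : fps_comp 1 G = 1.
Proof. by rewrite (@comp_delta _ mnm0) ?mon_subst0. Qed.

Lemma compX i : fps_comp (fpsX K i) G = G 0 i.
Proof. by rewrite (@comp_delta _ (mnm1 i)) ?mon_subst1. Qed.

(** Both sides are sums of f_b g_c G^(b + c); the products on the right that exceed
    the truncation degree vanish because of their order. *)
Lemma compM f g : fps_comp (f * g) G = fps_comp f G * fps_comp g G.
Proof.
apply/fpsP => a; set d := (mdeg a).+1; have ad : (mdeg a < d)%N by [].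
rewrite (fcoef_comp _ ad) (fcoefM_mons _ _ ad).
transitivity (\sum_(b <- mons m d) \sum_(c <- mons m d)
    f b * g c * mon_subst G (b +m c) a).
  transitivity (\sum_(e <- mons m d) \sum_(b <- mons m d | b <=m e)
      f b * g (e -m b) * mon_subst G e a).
    apply: eq_big_seq => e; rewrite mem_mons => ed.
    by rewrite (fcoefM_mons _ _ ed) mulr_suml.
  rewrite (exchange_big_dep predT) //=; apply: eq_big_seq => b _.
  rewrite big_mkcond /=.
  pose F c := f b * g c * mon_subst G (b +m c) a.
  transitivity (\sum_(c <- [seq e -m b | e <- mons m d & b <=m e]) F c).
    rewrite [RHS]big_map big_filter [RHS]big_mkcond; apply: eq_bigr => e _.
    by rewrite /F; case: ifP => // be; rewrite [b +m _]addmC submK.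
  apply: eq_big_supp; rewrite ?mons_uniq //.
    rewrite map_inj_in_uniq ?filter_uniq ?mons_uniq // => e e'.
    rewrite !mem_filter => /andP[be _] /andP[be' _] /(congr1 (mnm_add^~ b)).
    by rewrite !submK.
  move=> c Fc; have {Fc} bcd : (mdeg (b +m c) < d)%N.
    rewrite ltnNge; apply: contra Fc => dbc.
    by rewrite /F order_mon_subst ?mulr0 // (leq_trans ad).
  rewrite mem_mons (_ : (mdeg c < d)%N); last by move: bcd; rewrite mdegD; lia.
  apply/mapP; exists (b +m c); last by rewrite addmC addmK.
  by rewrite mem_filter lem_addr mem_mons.
transitivity (\sum_(e <- mons m d | true) \sum_(e' <- mons p d | e' <=m a)
    f e * mon_subst G e e' * fps_comp g G (a -m e')); last first.
  rewrite exchange_big [LHS]big_seq_cond [RHS]big_seq_cond; apply: eq_bigr => e'.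
  by rewrite mem_mons => /andP[ed _]; rewrite (fcoef_comp _ ed) mulr_suml.
apply: eq_bigr => b _.
transitivity (\sum_(e' <- mons p d | e' <=m a) \sum_(c <- mons m d)
   f b * g c * (mon_subst G b e' * mon_subst G c (a -m e'))).
  rewrite exchange_big /=; apply: eq_bigr => c _.
  by rewrite mon_substD (fcoefM_mons _ _ ad) mulr_sumr.
apply: eq_bigr => e' _; have ed : (mdeg (a -m e') < d)%N by rewrite ltnS mdegB.
rewrite (fcoef_comp _ ed) mulr_sumr; apply: eq_bigr => c _; ring.
Qed.

Lemma comp_sum I (r : seq I) (P : pred I) (F : I -> fps K m) :
  fps_comp (\sum_(i <- r | P i) F i) G = \sum_(i <- r | P i) fps_comp (F i) G.
Proof. exact: (big_morph (fun f => fps_comp f G) compD comp0). Qed.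

Lemma comp_exp f k : fps_comp (f ^+ k) G = fps_comp f G ^+ k.
Proof. by elim: k => [|k IH]; rewrite ?expr0 ?comp1 // !exprS compM IH. Qed.

Lemma comp_prod I (r : seq I) (P : pred I) (F : I -> fps K m) :
  fps_comp (\prod_(i <- r | P i) F i) G = \prod_(i <- r | P i) fps_comp (F i) G.
Proof. exact: (big_morph (fun f => fps_comp f G) compM comp1). Qed.

End Composition.

Section CompositionAssoc.
Variable K : comNzRingType.

Lemma fps_varsE m i : fps_vars K m 0 i = fpsX K i.
Proof. by rewrite mxE. Qed.

Lemma fps_vars_nct m i : fps_vars K m 0 i mnm0 = 0.
Proof. by rewrite fps_varsE /= eq_sym mnm1_eq0. Qed.

Lemma comp_vars_map m p (H : 'rV[fps K p]_m) : (forall i, H 0 i mnm0 = 0) ->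
  map_mx (fun f => fps_comp f H) (fps_vars K m) = H.
Proof. by move=> H0; apply/rowP => i; rewrite !mxE compX. Qed.

(** By multiplicativity, substituting H in G^b gives (G o H)^b; an exchange of
    sums does the rest. *)
Lemma comp_assoc m p q (f : fps K m) (G : 'rV[fps K p]_m) (H : 'rV[fps K q]_p) :
  (forall i, G 0 i mnm0 = 0) -> (forall i, H 0 i mnm0 = 0) ->
  fps_comp (fps_comp f G) H = fps_comp f (map_mx (fun g => fps_comp g H) G).
Proof.
move=> G0 H0; have GH0 i : (map_mx (fun g => fps_comp g H) G) 0 i mnm0 = 0.
  by rewrite mxE comp_coef0.
have GHE b : mon_subst (map_mx (fun g => fps_comp g H) G) b = fps_comp (mon_subst G b) H.
  rewrite /mon_subst comp_prod //; apply: eq_bigr => i _.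
  by rewrite mxE comp_exp.
apply/fpsP => a; set d := (mdeg a).+1; have ad : (mdeg a < d)%N by [].
rewrite !(fcoef_comp _ _ ad) //.
transitivity (\sum_(c <- mons p d) \sum_(b <- mons m d)
   f b * (mon_subst G b c * mon_subst H c a)).
  apply: eq_big_seq => c; rewrite mem_mons => cd.
  rewrite (fcoef_comp G0 _ cd) mulr_suml; apply: eq_bigr => b _; ring.
rewrite exchange_big; apply: eq_bigr => b _ /=.
by rewrite GHE (fcoef_comp H0 _ ad) mulr_sumr.
Qed.

Definition monom m (b : multinom m) : fps K m := FPS (fun a => (a == b)%:R).

Lemma monomM m (b c : multinom m) : monom b * monom c = monom (b +m c).
Proof.
apply/fpsP => a; have [->|abc] := eqVneq a (b +m c).
  rewrite fcoefM_single /= ?eqxx ?mulr1 // => b' c' /negPf ->; rewrite mul0r //.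
rewrite fcoefM_eq0 /= ?(negPf abc) // => b' c' e.
have [bb|] := eqVneq b' b; last by rewrite mul0r.
have [cc|] := eqVneq c' c; last by rewrite mulr0.
by move: abc; rewrite e bb cc eqxx.
Qed.

Lemma monomX m (b : multinom m) k : monom b ^+ k = monom (mnm_muln b k).
Proof.
elim: k => [|k IH]; first by rewrite expr0 mulm0n; apply/fpsP => a.
by rewrite exprS IH monomM mulmS.
Qed.

Lemma mon_subst_monom m p (G : 'rV[fps K p]_m) (phi : 'I_m -> multinom p) b :
  (forall i, G 0 i = monom (phi i)) ->
  mon_subst G b = monom (\big[@mnm_add p/@mnm0 p]_i mnm_muln (phi i) (b i)).
Proof.
move=> GE; rewrite /mon_subst.
rewrite (big_morph (@monom p) (fun b c => esym (monomM b c)) (id1 := 1)); last first.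
  by apply/fpsP => a.
by apply: eq_bigr => i _; rewrite GE monomX.
Qed.

End CompositionAssoc.

(** * Series in Z and Zbar as matrices *)

Section Monomials.
Variable K : comNzRingType.

(** For substitutions that rename or erase variables, each monomial of the result
    comes from a single monomial. *)
Lemma comp_coef_single m p (G : 'rV[fps K p]_m) (f : fps K m) a b0 :
  (forall i, G 0 i mnm0 = 0) ->
  (forall b, mon_subst G b a = (b == b0)%:R) -> fps_comp f G a = f b0.
Proof.
move=> G0 Ga; rewrite (fcoef_comp (d := (maxn (mdeg a) (mdeg b0)).+1) G0) ?ltnS ?leq_maxl //.
rewrite (bigD1_seq b0) ?mons_uniq ?mem_mons ?ltnS ?leq_maxr //= Ga eqxx mulr1.
by rewrite big1 ?addr0 // => b /negPf bb; rewrite Ga bb mulr0.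
Qed.

Lemma fpsXE m i : fpsX K i = monom K (mnm1 i) :> fps K m.
Proof. by []. Qed.

Lemma mon_subst_vars m b : mon_subst (fps_vars K m) b = monom K b.
Proof.
rewrite (@mon_subst_monom _ _ _ _ (fun i => mnm1 i)); last by move=> i; rewrite mxE.
by congr monom; rewrite [RHS]multinomUE_id.
Qed.

Lemma comp_vars m (f : fps K m) : fps_comp f (fps_vars K m) = f.
Proof.
apply/fpsP => a; apply: comp_coef_single => [|b]; first exact: fps_vars_nct.
by rewrite mon_subst_vars /= eq_sym.
Qed.

End Monomials.

Section Bidegree.
Variable N : nat.
Implicit Types (a b c : multinom N) (e : multinom (N + N)).

(** An exponent of (Z, Zbar) is a pair of exponents. A series in (Z, Zbar) thus
    becomes an infinite matrix, whose rows are indexed by the powers of Z and whose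
    columns are indexed by the powers of Zbar; its rank is the rank of the series. *)
Definition mcat a b : multinom (N + N) :=
  Multinom (mktuple (fun i => match fintype.split i with inl j => a j | inr j => b j end)).

Lemma mcatl a b i : mcat a b (lshift N i) = a i.
Proof. by rewrite mnmE (unsplitK (inl i)). Qed.

Lemma mcatr a b i : mcat a b (rshift N i) = b i.
Proof. by rewrite mnmE (unsplitK (inr i)). Qed.

Lemma mcat_surj e : exists a b, e = mcat a b.
Proof.
exists (Multinom (mktuple (fun i => e (lshift N i)))).
exists (Multinom (mktuple (fun i => e (rshift N i)))).
apply/mnmP => i; rewrite -(splitK i); case: (fintype.split i) => j /=.
  by rewrite mcatl mnmE.
by rewrite mcatr mnmE.
Qed.

Lemma mcat_inj a b a' b' : mcat a b = mcat a' b' -> a = a' /\ b = b'.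
Proof.
move=> /mnmP ab; split; apply/mnmP => i.
  by have := ab (lshift N i); rewrite !mcatl.
by have := ab (rshift N i); rewrite !mcatr.
Qed.

Lemma mcat_eq a b a' b' : (mcat a b == mcat a' b') = (a == a') && (b == b').
Proof.
by apply/eqP/andP => [/mcat_inj[-> ->]|[/eqP -> /eqP ->]].
Qed.

Lemma mcatD a b a' b' : mcat (a +m a') (b +m b') = mcat a b +m mcat a' b'.
Proof.
apply/mnmP => i; rewrite mnmDE -(splitK i); case: (fintype.split i) => j /=.
  by rewrite !mcatl mnmDE.
by rewrite !mcatr mnmDE.
Qed.

Lemma mdeg_mcat a b : mdeg (mcat a b) = (mdeg a + mdeg b)%N.
Proof.
rewrite !mdegE big_split_ord /=; congr addn; apply: eq_bigr => i _.
  by rewrite mcatl.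
by rewrite mcatr.
Qed.

Lemma mcat0 : mcat (@mnm0 N) (@mnm0 N) = @mnm0 (N + N).
Proof. by apply/eqP; rewrite -mdeg_eq0 mdeg_mcat !mdeg0. Qed.

Lemma mnm1_lshift i : mnm1 (lshift N i) = mcat (mnm1 i) (@mnm0 N).
Proof.
apply/mnmP => j; rewrite -(splitK j); case: (fintype.split j) => k /=.
  by rewrite mcatl !mnm1E eq_lshift.
by rewrite mcatr mnm1E mnm0E eq_lrshift.
Qed.

Lemma mnm1_rshift i : mnm1 (rshift N i) = mcat (@mnm0 N) (mnm1 i).
Proof.
apply/mnmP => j; rewrite -(splitK j); case: (fintype.split j) => k /=.
  by rewrite mcatl mnm1E mnm0E eq_rlshift.
by rewrite mcatr !mnm1E eq_rshift.
Qed.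

End Bidegree.

Section Bicoefficients.
Variables (K : comNzRingType) (N : nat).
Implicit Types (A B f g : fps K (N + N)) (F : fps K N) (a b c : multinom N).

Definition cf A a b := A (mcat a b).

Lemma cfP A B : (forall a b, cf A a b = cf B a b) -> A = B.
Proof. by move=> AB; apply/fpsP => e; have [a [b ->]] := mcat_surj e; apply: AB. Qed.

Lemma cfD A B a b : cf (A + B) a b = cf A a b + cf B a b. Proof. by []. Qed.
Lemma cfB A B a b : cf (A - B) a b = cf A a b - cf B a b. Proof. by []. Qed.
Lemma cfZ k A a b : cf (k *: A) a b = k * cf A a b. Proof. by []. Qed.
Lemma cf0 a b : cf 0 a b = 0. Proof. by []. Qed.
Lemma cf1 a b : cf 1 a b = ((a == mnm0) && (b == mnm0))%:R.
Proof. by rewrite -mcat_eq mcat0. Qed.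
Lemma cf_sum I (r : seq I) (P : pred I) (E : I -> fps K (N + N)) a b :
  cf (\sum_(i <- r | P i) E i) a b = \sum_(i <- r | P i) cf (E i) a b.
Proof. exact: fcoef_sum. Qed.

Lemma cfM_eq0 A B a b :
  (forall a1 a2 b1 b2, a = a1 +m a2 -> b = b1 +m b2 -> cf A a1 b1 * cf B a2 b2 = 0) ->
  cf (A * B) a b = 0.
Proof.
move=> AB; apply: fcoefM_eq0 => e e'.
have [a1 [b1 ->]] := mcat_surj e; have [a2 [b2 ->]] := mcat_surj e'.
by rewrite -mcatD => /mcat_inj[]; apply: AB.
Qed.

Lemma cfM_single A B a b a' b' :
  (forall a1 a2 b1 b2, (a1, b1) != (a, b) -> a +m a' = a1 +m a2 -> b +m b' = b1 +m b2 ->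
     cf A a1 b1 * cf B a2 b2 = 0) ->
  cf (A * B) (a +m a') (b +m b') = cf A a b * cf B a' b'.
Proof.
move=> AB; rewrite /cf mcatD; apply: fcoefM_single => e e'.
have [a1 [b1 ->]] := mcat_surj e; have [a2 [b2 ->]] := mcat_surj e'.
by rewrite mcat_eq -!mcatD => ne /mcat_inj[aa bb]; apply: AB.
Qed.

Lemma mon_subst_row_mx p (G1 G2 : 'rV[fps K p]_N) a b :
  mon_subst (row_mx G1 G2) (mcat a b) = mon_subst G1 a * mon_subst G2 b.
Proof.
rewrite /mon_subst big_split_ord /=; congr (_ * _); apply: eq_bigr => i _.
  by rewrite row_mxEl mcatl.
by rewrite row_mxEr mcatr.
Qed.

Lemma big_mons_mcat d (E : multinom (N + N) -> K) :
  (forall e, (d <= mdeg e)%N -> E e = 0) ->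
  \sum_(e <- mons (N + N) d) E e =
  \sum_(b <- mons N d) \sum_(c <- mons N d) E (mcat b c).
Proof.
move=> Ed; rewrite -(big_allpairs_dep (h := fun b c => mcat b c) (F := E)).
apply: eq_big_supp; rewrite ?mons_uniq //.
  apply: allpairs_uniq; rewrite ?mons_uniq //.
  by move=> [b c] [b' c'] _ _ /= /mcat_inj[-> ->].
move=> e Ee; have ed : (mdeg e < d)%N.
  by rewrite ltnNge; apply: contra Ee => /Ed ->.
rewrite mem_mons ed; apply/esym/allpairsP; have [b [c ec]] := mcat_surj e.
by exists (b, c); rewrite /= !mem_mons; split => //; move: ed; rewrite ec mdeg_mcat; lia.
Qed.

Lemma lsub_varsE i : lsubmx (fps_vars K (N + N)) 0 i = monom K (mcat (mnm1 i) mnm0).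
Proof. by rewrite !mxE fpsXE mnm1_lshift. Qed.

Lemma rsub_varsE i : rsubmx (fps_vars K (N + N)) 0 i = monom K (mcat mnm0 (mnm1 i)).
Proof. by rewrite !mxE fpsXE mnm1_rshift. Qed.

Lemma lsub_vars_nct i : lsubmx (fps_vars K (N + N)) 0 i mnm0 = 0.
Proof. by rewrite mxE fps_vars_nct. Qed.

Lemma rsub_vars_nct i : rsubmx (fps_vars K (N + N)) 0 i mnm0 = 0.
Proof. by rewrite mxE fps_vars_nct. Qed.

Lemma mon_subst_lsub a :
  mon_subst (lsubmx (fps_vars K (N + N))) a = monom K (mcat a mnm0).
Proof.
rewrite (@mon_subst_monom _ _ _ _ (fun i => mcat (mnm1 i) mnm0)); last exact: lsub_varsE.
congr monom; rewrite [in RHS](multinomUE_id a).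
have D : {morph (fun a => mcat a (@mnm0 N)) : x y / mnm_add x y >-> mnm_add x y}.
  by move=> x y; rewrite -mcatD addm0.
rewrite (big_morph _ D (mcat0 N)); apply: eq_bigr => i _.
by elim: (a i) => [|k IH]; rewrite ?mulm0n ?mcat0 // !mulmS D IH.
Qed.

Lemma mon_subst_rsub a :
  mon_subst (rsubmx (fps_vars K (N + N))) a = monom K (mcat mnm0 a).
Proof.
rewrite (@mon_subst_monom _ _ _ _ (fun i => mcat mnm0 (mnm1 i))); last exact: rsub_varsE.
congr monom; rewrite [in RHS](multinomUE_id a).
have D : {morph (fun a => mcat (@mnm0 N) a) : x y / mnm_add x y >-> mnm_add x y}.
  by move=> x y; rewrite -mcatD addm0.
rewrite (big_morph _ D (mcat0 N)); apply: eq_bigr => i _.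
by elim: (a i) => [|k IH]; rewrite ?mulm0n ?mcat0 // !mulmS D IH.
Qed.

End Bicoefficients.

Arguments cf : simpl never.

Lemma iter_fps_deriv (K : comNzRingType) m (j : 'I_m) q (f : fps K m) e :
  iter q (fps_deriv j) f e = ((e j + q) ^_ q)%:R * f (e +m mnm_muln (mnm1 j) q).
Proof.
elim: q f e => [|q IH] f e; first by rewrite mulm0n addm0 ffactn0 mul1r.
rewrite iterSr IH [fps_deriv _ _ _]/= mulrA -natrM -addmA -mulmSr; congr (_%:R * _).
by rewrite mnmDE mulmnE mnm1E eqxx mul1n addnS ffactnS mulnC.
Qed.

(** As phi is injective, deriving in one of the variables leaves the exponents of
    the others unchanged, and each variable contributes its own factorial. *)
Lemma multi_deriv_coef (K : comNzRingType) m p (phi : 'I_p -> 'I_m) (b : multinom p)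
    (A : fps K m) (e : multinom m) : injective phi -> (forall i, e (phi i) = 0%N) ->
  multi_deriv (fun i => fps_deriv (phi i)) b A e =
    (\prod_i (b i)`!)%:R
    * A (e +m \big[@mnm_add m/@mnm0 m]_i mnm_muln (mnm1 (phi i)) (b i)).
Proof.
move=> phi_inj e0; rewrite /multi_deriv.
have {e0} : forall i, i \in enum 'I_p -> e (phi i) = 0%N by [].
rewrite -[X in X%:R]big_enum -[X in _ +m X]big_enum /=.
elim: (enum 'I_p) (enum_uniq 'I_p) e => [|i s IH] /= us e e0.
  by rewrite !big_nil addm0 mul1r.
have /andP[ins us'] := us.
rewrite !big_cons iter_fps_deriv e0 ?inE ?eqxx // add0n ffactnn IH //.
  by rewrite natrM mulrA addmA.
move=> i' i's; rewrite mnmDE mulmnE mnm1E e0 ?inE ?i's ?orbT // (inj_eq phi_inj).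
by case: eqP i's ins => // ->; move=> ->.
Qed.

Section Conjugation.
Variables (R : realType) (N : nat).
Local Notation C := R[i].
Implicit Types (A B : fps C (N + N)) (F : fps C N) (a b c : multinom N) (H : 'rV[fps C N]_N).

Lemma Zvars_nct i : Zvars R N 0 i mnm0 = 0. Proof. exact: lsub_vars_nct. Qed.
Lemma Zbars_nct i : Zbars R N 0 i mnm0 = 0. Proof. exact: rsub_vars_nct. Qed.

Lemma row_mx_nct p (G1 G2 : 'rV[fps C p]_N) :
  (forall i, G1 0 i mnm0 = 0) -> (forall i, G2 0 i mnm0 = 0) ->
  forall i, row_mx G1 G2 0 i mnm0 = 0.
Proof. by move=> G10 G20 i; rewrite mxE; case: fintype.split. Qed.

Lemma at_Zbar0E A a : at_Zbar0 A a = cf A a mnm0.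
Proof.
apply: comp_coef_single.
  by apply: row_mx_nct => i; rewrite ?fps_vars_nct // mxE.
move=> e; have [b [c ->]] := mcat_surj e.
rewrite mon_subst_row_mx mon_subst_vars mcat_eq.
have [->|c0] := eqVneq c mnm0; first by rewrite mon_subst0 mulr1 andbT eq_sym.
suff -> : mon_subst (0 : 'rV[fps C N]_N) c = 0 by rewrite mulr0 andbF.
have [i ci] : exists i, c i != 0%N.
  apply/existsP; move: c0; apply: contra_neqT; rewrite negb_exists => /forallP c0.
  by apply/mnmP => i; rewrite mnm0E; have := c0 i; rewrite negbK => /eqP.
by rewrite /mon_subst (bigD1 i) //= mxE expr0n (negPf ci) mul0r.
Qed.

Lemma at_Zbar0_nct i : row_mx (fps_vars C N) (0 : 'rV_N) 0 i mnm0 = 0.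
Proof. by apply: row_mx_nct => j; rewrite ?fps_vars_nct // mxE. Qed.

Lemma cf_holo F a b : cf (holo F) a b = F a *+ (b == mnm0).
Proof.
have [->|b0] := eqVneq b mnm0.
  rewrite mulr1n; apply: comp_coef_single => [|c]; first exact: Zvars_nct.
  by rewrite mon_subst_lsub /= mcat_eq eqxx andbT eq_sym.
rewrite mulr0n /cf /holo (fcoef_comp Zvars_nct _ (ltnSn _)) big1 // => c _.
by rewrite mon_subst_lsub /= mcat_eq (negPf b0) andbF mulr0.
Qed.

Lemma cf_conj A a b : cf (fps_conj A) a b = (cf A b a)^*.
Proof.
apply: (@comp_coef_single _ _ _ _ _ _ (mcat b a)).
  by apply: row_mx_nct => i; [apply: Zbars_nct|apply: Zvars_nct].
move=> e; have [c [d ->]] := mcat_surj e.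
rewrite mon_subst_row_mx mon_subst_rsub mon_subst_lsub monomM -mcatD add0m addm0 /=.
by rewrite !mcat_eq andbC ![_ == c]eq_sym ![_ == d]eq_sym.
Qed.

Lemma fps_conjK : involutive (@fps_conj R N).
Proof. by move=> A; apply: cfP => a b; rewrite !cf_conj conjCK. Qed.

Lemma fps_conjD A B : fps_conj (A + B) = fps_conj A + fps_conj B.
Proof. by apply: cfP => a b; rewrite cfD !cf_conj cfD rmorphD. Qed.

Lemma fps_conjB A B : fps_conj (A - B) = fps_conj A - fps_conj B.
Proof. by apply: cfP => a b; rewrite cfB !cf_conj cfB rmorphB. Qed.

Lemma fps_conjZ k A : fps_conj (k *: A) = k^* *: fps_conj A.
Proof. by apply: cfP => a b; rewrite cfZ !cf_conj cfZ rmorphM. Qed.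

Lemma fps_conj1 : fps_conj (1 : fps C (N + N)) = 1.
Proof. by apply: cfP => a b; rewrite cf_conj !cf1 andbC rmorph_nat. Qed.

Lemma fps_conj_sum I (r : seq I) (P : pred I) (E : I -> fps C (N + N)) :
  fps_conj (\sum_(i <- r | P i) E i) = \sum_(i <- r | P i) fps_conj (E i).
Proof.
apply: (big_morph (@fps_conj R N) fps_conjD); apply: cfP => a b.
by rewrite cf_conj !cf0 rmorph0.
Qed.

Lemma fps_conjM A B : fps_conj (A * B) = fps_conj A * fps_conj B.
Proof.
rewrite /fps_conj -compM; last first.
  by apply: row_mx_nct => i; [apply: Zbars_nct|apply: Zvars_nct].
congr fps_comp; apply/fpsP => e; rewrite -[LHS]/(((A * B) e)^*) !(fcoefM_mons _ _ (ltnSn _)).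
by rewrite rmorph_sum; apply: eq_bigr => b _; rewrite rmorphM.
Qed.

Lemma holoM F G : holo (F * G : fps C N) = holo F * holo G.
Proof. by rewrite /holo compM //; exact: Zvars_nct. Qed.

Lemma holoZ k F : holo (k *: F) = k *: holo F.
Proof. by rewrite /holo compZ //; exact: Zvars_nct. Qed.

Lemma holoX i : holo (fpsX C i) = Zvars R N 0 i.
Proof. by rewrite /holo compX //; exact: Zvars_nct. Qed.

Lemma conj_holoX i : fps_conj (holo (fpsX C i)) = Zbars R N 0 i.
Proof.
apply: cfP => a b; rewrite cf_conj cf_holo rsub_varsE /cf /= mcat_eq andbC.
by case: (a == _); rewrite ?mulr1n ?mulr0n ?andbF ?rmorph0 // andbT rmorph_nat.
Qed.

Lemma cf_conj_holo F a b : cf (fps_conj (holo F)) a b = (F b)^* *+ (a == mnm0).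
Proof. by rewrite cf_conj cf_holo rmorphMn. Qed.

Lemma cf_holo_conj F G a b : cf (holo F * fps_conj (holo G)) a b = F a * (G b)^*.
Proof.
rewrite -{1}[a]addm0 -{1}[b]add0m cfM_single.
  by rewrite cf_holo cf_conj_holo !eqxx !mulr1n.
move=> a1 a2 b1 b2 ne ea eb; rewrite cf_holo cf_conj_holo.
have [b10|] := eqVneq b1 mnm0; last by rewrite mulr0n mul0r.
have [a20|] := eqVneq a2 mnm0; last by rewrite mulr0n mulr0.
by move: ne; rewrite b10 (_ : a1 = a) ?eqxx // -[LHS]addm0 -a20 -ea addm0.
Qed.

Lemma cf_holoM F A a b d : (mdeg a < d)%N ->
  cf (holo F * A) a b = \sum_(c <- mons N d | c <=m a) F c * cf A (a -m c) b.
Proof.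
move=> ad; set d' := (mdeg (mcat a b)).+1.
pose s := [seq mcat c (@mnm0 N) | c <- mons N d].
rewrite /cf (fcoefM_mons _ _ (ltnSn _)) -/d' big_mkcond.
transitivity (\sum_(e <- s) if e <=m mcat a b then holo F e * A (mcat a b -m e) else 0).
  apply: eq_big_supp; rewrite ?mons_uniq //.
    by rewrite map_inj_uniq ?mons_uniq // => c c' /mcat_inj[].
  move=> e; case: ifP; rewrite ?eqxx // => eab.
  have [a1 [b1 ee]] := mcat_surj e; rewrite ee -/(cf (holo F) a1 b1) cf_holo.
  have [b10|] := eqVneq b1 mnm0; last by rewrite mulr0n mul0r eqxx.
  move=> _; rewrite mem_mons ltnS -{1}(submK eab) mdegD ee leq_addl b10.
  apply/esym/mapP; exists a1 => //; rewrite mem_mons; apply: leq_ltn_trans ad.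
  rewrite !mdegE leq_sum // => i _; have /mnm_lepP/(_ (lshift N i)) := eab.
  by rewrite ee !mcatl.
rewrite [LHS]big_map [RHS]big_mkcond; apply: eq_bigr => c _.
have -> : (mcat c mnm0 <=m mcat a b) = (c <=m a).
  apply/mnm_lepP/mnm_lepP => ca i; first by have := ca (lshift N i); rewrite !mcatl.
  rewrite -(splitK i); case: (fintype.split i) => j /=; first by rewrite !mcatl.
  by rewrite !mcatr mnm0E.
case: ifP => // ca; rewrite -/(cf (holo F) c mnm0) cf_holo eqxx mulr1n; congr (_ * A _).
by rewrite -[in LHS](submK ca) -[b in LHS]addm0 mcatD addmK.
Qed.

Lemma mon_subst_map_holo H a : mon_subst (map_mx (fun F => holo F) H) a = holo (mon_subst H a).
Proof.
rewrite /mon_subst /holo comp_prod; last exact: Zvars_nct.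
by apply: eq_bigr => i _; rewrite mxE comp_exp //; exact: Zvars_nct.
Qed.

Lemma fps_conj_prod I (r : seq I) (P : pred I) (E : I -> fps C (N + N)) :
  fps_conj (\prod_(i <- r | P i) E i) = \prod_(i <- r | P i) fps_conj (E i).
Proof. exact: (big_morph (@fps_conj R N) fps_conjM fps_conj1). Qed.

Lemma fps_conj_exp A k : fps_conj (A ^+ k) = fps_conj A ^+ k.
Proof. by elim: k => [|k IH]; rewrite ?expr0 ?fps_conj1 // !exprS fps_conjM IH. Qed.

Lemma mon_subst_map_conj H a :
  mon_subst (map_mx (fun F => fps_conj (holo F)) H) a = fps_conj (holo (mon_subst H a)).
Proof.
rewrite -mon_subst_map_holo /mon_subst fps_conj_prod.
by apply: eq_bigr => i _; rewrite !mxE fps_conj_exp.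
Qed.

Lemma holo_nct F : F mnm0 = 0 -> holo F mnm0 = 0.
Proof. by move=> F0; rewrite -mcat0 -/(cf _ _ _) cf_holo eqxx F0. Qed.

Lemma conj_holo_nct F : F mnm0 = 0 -> fps_conj (holo F) mnm0 = 0.
Proof. by move=> F0; rewrite -mcat0 -/(cf _ _ _) cf_conj_holo eqxx F0 rmorph0. Qed.

Lemma comp_bar_nct H : no_constant_term H -> forall i,
  row_mx (map_mx (fun F => holo F) H) (map_mx (fun F => fps_conj (holo F)) H) 0 i mnm0 = 0.
Proof.
move=> H0; apply: row_mx_nct => i; rewrite mxE; first exact: holo_nct.
exact: conj_holo_nct.
Qed.

(** Substitution of (H, Hbar) is a matrix product: A becomes X A X^*, where the
    matrix X holds the coefficients of the powers of H. *)
Lemma cf_comp_bar A H a b d : no_constant_term H -> (mdeg a + mdeg b < d)%N ->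
  cf (comp_bar A H) a b = \sum_(a' <- mons N d) \sum_(b' <- mons N d)
     mon_subst H a' a * cf A a' b' * (mon_subst H b' b)^*.
Proof.
move=> H0 abd; rewrite /cf /comp_bar (@fcoef_comp _ _ _ _ (comp_bar_nct H0) d); last first.
  by rewrite mdeg_mcat.
rewrite big_mons_mcat; last first.
  move=> e de; rewrite (order_mon_subst (comp_bar_nct H0)) ?mulr0 //.
  by rewrite mdeg_mcat (leq_trans abd).
apply: eq_bigr => a' _; apply: eq_bigr => b' _.
rewrite mon_subst_row_mx mon_subst_map_holo mon_subst_map_conj.
by rewrite -/(cf _ a b) cf_holo_conj mulrA [A _ * _]mulrC.
Qed.

Lemma conj_comp_bar A H : no_constant_term H ->
  fps_conj (comp_bar A H) = comp_bar (fps_conj A) H.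
Proof.
move=> H0; apply: cfP => a b; rewrite [LHS]cf_conj.
have ab : (mdeg a + mdeg b < (mdeg a + mdeg b).+1)%N by [].
have ba : (mdeg b + mdeg a < (mdeg a + mdeg b).+1)%N by rewrite addnC.
rewrite [X in X^*](cf_comp_bar _ H0 ba) [RHS](cf_comp_bar _ H0 ab) rmorph_sum exchange_big.
apply: eq_bigr => b' _; rewrite rmorph_sum; apply: eq_bigr => a' _.
rewrite !rmorphM /= conjCK cf_conj; ring.
Qed.

End Conjugation.

(** * Rank *)

Section Rank.
Variables (R : realType) (N : nat).
Local Notation C := R[i].
Implicit Types (A B : fps C (N + N)) (F : fps C N) (H : 'rV[fps C N]_N).

Definition submx_of A p q (r : 'I_p -> multinom N) (s : 'I_q -> multinom N) : 'M[C]_(p, q) :=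
  \matrix_(i, j) cf A (r i) (s j).

(** Finite submatrices suffice to bound the dimension of the span of the columns,
    and for them the inequalities on the ranks of sums and products are available. *)
Definition rank_le k A := forall p q (r : 'I_p -> multinom N) (s : 'I_q -> multinom N),
  (\rank (submx_of A r s) <= k)%N.

Lemma rank_leB k1 k2 A B : rank_le k1 A -> rank_le k2 B -> rank_le (k1 + k2) (A - B).
Proof.
move=> A1 B2 p q r s.
have -> : submx_of (A - B) r s = submx_of A r s + - submx_of B r s.
  by apply/matrixP => i j; rewrite !mxE.
apply: leq_trans (mxrank_add _ _) _; rewrite mxrank_opp; exact: leq_add.
Qed.

Lemma rank_leZ k c A : rank_le k A -> rank_le k (c *: A).
Proof.
move=> A1 p q r s.
have -> : submx_of (c *: A) r s = c *: submx_of A r s.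
  by apply/matrixP => i j; rewrite !mxE.
by apply: leq_trans (mxrank_scale _ _) (A1 _ _ _ _).
Qed.

Lemma rank_le_conj k A : rank_le k A -> rank_le k (fps_conj A).
Proof.
move=> A1 p q r s.
have -> : submx_of (fps_conj A) r s = (map_mx Num.conj (submx_of A s r))^T.
  by apply/matrixP => i j; rewrite !mxE cf_conj.
by rewrite mxrank_tr mxrank_map.
Qed.

Lemma big_mons_rev (V : nmodType) d (a : multinom N) (E : multinom N -> V) : (mdeg a < d)%N ->
  \sum_(c <- mons N d | c <=m a) E c = \sum_(c <- mons N d | c <=m a) E (a -m c).
Proof.
move=> ad; rewrite -big_filter -[RHS]big_filter.
set s := [seq c <- mons N d | c <=m a].
have subs c : c \in s = (c <=m a).
  rewrite mem_filter mem_mons; case: (boolP (c <=m a)) => //= ca.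
  by apply: leq_ltn_trans ad; rewrite -(submK ca) mdegD leq_addl.
rewrite -[RHS](big_map (fun c => a -m c) predT E); apply: perm_big; apply: uniq_perm.
- by rewrite filter_uniq ?mons_uniq.
- rewrite map_inj_in_uniq ?filter_uniq ?mons_uniq // => c c'; rewrite !subs => ca c'a.
  by move=> e; apply: (@addmI _ (a -m c)); rewrite submK // e submK.
move=> c; rewrite subs; apply/idP/mapP => [ca|[c' _ ->]]; last exact: lem_subr.
exists (a -m c); rewrite ?subs ?lem_subr //.
by apply: (addIm (x := a -m c)); rewrite addmC submK // submK ?lem_subr.
Qed.

(** Multiplication by F(Z) combines the rows, so it is a matrix product on the left. *)
Lemma rank_le_holoM k F A : rank_le k A -> rank_le k (holo F * A).
Proof.
move=> A1 p q r s; pose d := (\max_i mdeg (r i)).+1.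
pose t := in_tuple (mons N d).
pose X : 'M[C]_(p, size (mons N d)) :=
  \matrix_(i, c) (F (r i -m tnth t c) *+ (tnth t c <=m r i)).
have -> : submx_of (holo F * A) r s = X *m submx_of A (tnth t) s.
  apply/matrixP => i j; rewrite !mxE.
  have rd : (mdeg (r i) < d)%N by rewrite ltnS (leq_bigmax i).
  rewrite (cf_holoM _ _ _ rd) big_mons_rev // big_mkcond (big_tnth _ _ (mons N d)).
  apply: eq_bigr => c _; rewrite !mxE; case: ifP => [cr|_]; last by rewrite mul0r.
  congr (_ * cf A _ _); apply: (addIm (x := r i -m tnth t c)).
  by rewrite submK ?lem_subr // addmC submK.
by apply: leq_trans (mxrankM_maxr _ _) (A1 _ _ _ _).
Qed.

Lemma rank_le_conj_holoM k F A : rank_le k A -> rank_le k (fps_conj (holo F) * A).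
Proof.
move=> A1; rewrite -[X in rank_le k X]fps_conjK fps_conjM fps_conjK.
exact/rank_le_conj/rank_le_holoM/rank_le_conj.
Qed.

Lemma rank_le_comp_bar k A H : no_constant_term H -> rank_le k A ->
  rank_le k (comp_bar A H).
Proof.
move=> H0 A1 p q r s; pose d := (\max_i mdeg (r i) + \max_j mdeg (s j)).+1.
pose t := in_tuple (mons N d).
pose X : 'M[C]_(p, size (mons N d)) := \matrix_(i, c) mon_subst H (tnth t c) (r i).
pose Y : 'M[C]_(size (mons N d), q) := \matrix_(c, j) (mon_subst H (tnth t c) (s j))^*.
have -> : submx_of (comp_bar A H) r s = X *m submx_of A (tnth t) (tnth t) *m Y.
  apply/matrixP => i j; rewrite !mxE.
  have rd : (mdeg (r i) + mdeg (s j) < d)%N.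
    by rewrite ltnS leq_add // ?(leq_bigmax i) ?(leq_bigmax j).
  rewrite (cf_comp_bar _ H0 rd) exchange_big (big_tnth _ _ (mons N d)).
  apply: eq_bigr => b _; rewrite !mxE (big_tnth _ _ (mons N d)) mulr_suml.
  by apply: eq_bigr => a _; rewrite !mxE.
apply: leq_trans (mxrankM_maxl _ _) _.
by apply: leq_trans (mxrankM_maxr _ _) (A1 _ _ _ _).
Qed.

(** Up to a factorial, the b-th derivative in Zbar at Zbar = 0 is the b-th column. *)
Lemma VA_column A (b : multinom N) :
  VA A (FPS (fun a => (\prod_i (b i)`!)%:R * cf A a b)).
Proof.
exists 1%N, (fun=> 1), (fun=> at_Zbar0 (multi_deriv (fun i => fps_deriv (rshift N i)) b A)).
split=> [_|]; first by exists b.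
rewrite big_ord1 scale1r; apply/fpsP => a; rewrite at_Zbar0E [RHS]/=.
rewrite /cf multi_deriv_coef; first last.
- by move=> i; rewrite mcatr mnm0E.
- exact: rshift_inj.
congr (_ * A _); rewrite -[a in LHS]addm0 -[b in LHS]add0m mcatD; congr (_ +m _).
apply/mnmP => j; rewrite mnm_sumE -(splitK j); case: (fintype.split j) => i /=.
  rewrite mcatl mnm0E big1 // => i' _.
  by rewrite mulmnE mnm1_rshift mcatl mnm0E.
rewrite mcatr (bigD1 i) //= mulmnE mnm1_rshift mcatr mnm1E eqxx mul1n.
rewrite big1 ?addn0 // => i' /negPf i'i.
by rewrite mulmnE mnm1_rshift mcatr mnm1E i'i.
Qed.

Lemma prod_fact_neq0 (b : multinom N) : (\prod_i (b i)`!)%:R != 0 :> C.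
Proof. by rewrite pnatr_eq0 -lt0n; apply: prodn_gt0 => i; rewrite fact_gt0. Qed.

(** A submatrix of rank more than k has k + 1 independent columns, which come from
    k + 1 independent elements of VA. *)
Lemma dim_le_rank k A : dim_le (VA A) k -> rank_le k A.
Proof.
move=> dA p q r s; rewrite leqNgt; apply/negP => kr.
set M := submx_of A r s in kr; rewrite -mxrank_tr in kr.
pose f := maxrankfun M^T; pose g (i : 'I_k.+1) := f (widen_ord kr i).
pose fact i : C := (\prod_j (s (g i) j)`!)%:R.
have [c [[i0 ci0] c0]] := dA _ (fun i => VA_column A (s (g i))).
pose c' : 'rV[C]_(\rank M^T) :=
  \row_j (if insub (j : nat) is Some i then c i * fact i else 0).
have c'i i : c' 0 (widen_ord kr i) = c i * fact i.
  by rewrite mxE /= insubT //= => ki; congr (c _ * fact _); apply: val_inj.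
suff /(row_free_inj (maxrowsub_free M^T)) c'0 : c' *m rowsub f M^T = 0 *m rowsub f M^T.
  move: (c'i i0); rewrite c'0 mxE => /esym/eqP; rewrite mulf_eq0 (negPf ci0) /=.
  by apply/negP/prod_fact_neq0.
rewrite mul0mx; apply/rowP => i; rewrite !mxE.
transitivity (\sum_(j < k.+1) c j * fact j * cf A (r i) (s (g j))).
  rewrite (bigID (fun j : 'I_(\rank M^T) => (j < k.+1)%N)) /= [X in _ + X]big1 ?addr0.
    by rewrite (big_ord_narrow kr); apply: eq_bigr => j _; rewrite c'i !mxE.
  by move=> j jk; rewrite mxE insubF ?mul0r //; apply/negbTE.
rewrite -[RHS](@fcoef0 C N (r i)) -c0 fcoef_sum.
by apply: eq_bigr => j _; rewrite fcoefZ /= mulrA.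
Qed.

Definition bi_order_ge2 A := forall a b, ((mdeg a < 2) || (mdeg b < 2))%N -> cf A a b = 0.

(** The condition on VA says that the rows of index at most 1 vanish; since A is
    real, so do the columns. *)
Lemma Hclass_order k A : Hclass k A -> bi_order_ge2 A.
Proof.
case=> Ar _ A2 a b.
wlog ab : a b / (mdeg a < 2)%N => [wl|_].
  case/orP => [a2|b2]; first by apply: wl; rewrite ?a2.
  by rewrite -Ar cf_conj wl ?rmorph0 ?b2.
have /eqP := A2 _ (VA_column A b) a ab; rewrite /= mulf_eq0 => /orP[|/eqP //].
by rewrite (negPf (prod_fact_neq0 b)).
Qed.

Lemma Hclass_rank k A : Hclass k A -> rank_le k A.
Proof. by case=> _ /dim_le_rank. Qed.

Lemma bi_order_comp_bar A H : no_constant_term H -> bi_order_ge2 A ->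
  bi_order_ge2 (comp_bar A H).
Proof.
move=> H0 A2 a b ab; rewrite (cf_comp_bar _ H0 (ltnSn _)).
rewrite big1 // => a' _; rewrite big1 // => b' _.
have [a'a|a'a] := ltnP (mdeg a) (mdeg a'); first by rewrite (order_mon_subst H0) ?mul0r.
have [b'b|b'b] := ltnP (mdeg b) (mdeg b').
  by rewrite (order_mon_subst H0 b'b) rmorph0 mulr0.
rewrite A2 ?mulr0 ?mul0r //; case/orP: ab => ?; apply/orP; [left|right]; lia.
Qed.

Lemma bi_order_holoM A F : bi_order_ge2 A -> bi_order_ge2 (holo F * A).
Proof.
move=> A2 a b ab; rewrite (cf_holoM _ _ _ (ltnSn _)) big1 // => c ca.
rewrite A2 ?mulr0 //; case/orP: ab => ?; apply/orP; [left|right] => //.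
by apply: leq_ltn_trans (mdegB _ _) _.
Qed.

Lemma bi_order_conj A : bi_order_ge2 A -> bi_order_ge2 (fps_conj A).
Proof. by move=> A2 a b ab; rewrite cf_conj A2 ?rmorph0 // orbC. Qed.

Lemma bi_order_conj_holoM A F : bi_order_ge2 A -> bi_order_ge2 (fps_conj (holo F) * A).
Proof.
move=> A2; rewrite -[X in bi_order_ge2 X]fps_conjK fps_conjM fps_conjK.
exact/bi_order_conj/bi_order_holoM/bi_order_conj.
Qed.

Lemma bi_orderZ A c : bi_order_ge2 A -> bi_order_ge2 (c *: A).
Proof. by move=> A2 a b ab; rewrite cfZ A2 ?mulr0. Qed.

End Rank.

(** * Huang's lemma *)

Lemma seq_maximum (T : eqType) (r : rel T) (s : seq T) : total r -> transitive r ->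
  s != [::] -> exists2 x, x \in s & forall y, y \in s -> r y x.
Proof.
move=> tr trr; elim: s => [//|x s IH] _.
have [->|/IH[z zs zmax]] := eqVneq s [::].
  exists x; rewrite ?mem_head // => y; rewrite inE => /eqP ->.
  by have := tr x x; rewrite orbb.
have [xz|zx] := orP (tr x z).
  exists z; rewrite ?inE ?zs ?orbT // => y; rewrite inE => /predU1P[->//|]; exact: zmax.
exists x; rewrite ?mem_head // => y; rewrite inE => /predU1P[->|/zmax yz].
  by have := tr x x; rewrite orbb.
exact: trr yz zx.
Qed.

Section Huang.
Variables (K : fieldType) (N n : nat) (iota : 'I_n -> 'I_N) (eps : 'I_n -> K).
Variables (P : multinom N -> multinom N -> K) (d : nat).
Hypothesis iota_inj : injective iota.
Hypothesis eps_neq0 : forall j, eps j != 0.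
Hypothesis P_bounded : forall a b, P a b != 0 -> (mdeg a < d)%N && (mdeg b < d)%N.

Let e j : multinom N := mnm1 (iota j).

(** The coefficient of Z^a Zbar^b in the product of P(Z, Zbar) with the form
    eps_1 Z_1 Zbar_1 + ... + eps_n Z_n Zbar_n, where Z_j stands for the variable of
    index iota j. *)
Definition mul_form a b : K :=
  \sum_j eps j * (if (e j <=m a) && (e j <=m b) then P (a -m e j) (b -m e j) else 0).

(** The monomial order on the differences x.1 - x.2, stated without subtraction. *)
Definition exponent_le (x y : multinom N * multinom N) := (x.1 +m y.2 <= y.1 +m x.2)%O.

Lemma exponent_le_total : total exponent_le.
Proof. by move=> x y; exact: le_total. Qed.

Lemma exponent_le_trans : transitive exponent_le.
Proof.
move=> [y1 y2] [x1 x2] [z1 z2]; rewrite /exponent_le /= => xy yz.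
rewrite -(lemc_add2r (y2 +m y1)).
have -> : y2 +m y1 +m (x1 +m z2) = (x1 +m y2) +m (y1 +m z2).
  by apply/mnmP => i; rewrite !mnmDE; lia.
have -> : y2 +m y1 +m (z1 +m x2) = (y1 +m x2) +m (z1 +m y2).
  by apply/mnmP => i; rewrite !mnmDE; lia.
exact: lem_add.
Qed.

(** Huang's lemma: the product of a nonzero polynomial P(Z, Zbar) with a
    nondegenerate form in n variables has rank at least n.

    The form is invariant under Z_j -> t_j Z_j, Zbar_j -> t_j^-1 Zbar_j, hence
    multiplication by it preserves the weight a - b of a monomial Z^a Zbar^b. Let
    a0 - b0 be the largest weight that occurs in P. For each i, choose a monomial
    (mu_i, nu_i) of this weight in P, of maximal degree in Z_i. No other term of
    the product cancels its multiple by Z_i Zbar_i, and the n monomials obtained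
    in this way are distinct, because the i-th one is the only one whose degree in
    Z_i exceeds this maximum. On the rows and columns of these monomials, the
    matrix of the product is triangular: an entry on the wrong side of the
    diagonal would come from a monomial of P of weight larger than a0 - b0. *)
Lemma huang_submatrix : (exists a b, P a b != 0) ->
  exists mu nu : 'I_n -> multinom N, (forall i, P (mu i) (nu i) != 0) /\
    \rank (\matrix_(i < n, j < n) mul_form (mu i +m e i) (nu j +m e j)) = n.
Proof.
move=> [a1 [b1 Pab1]].
pose supp := [seq x <- [seq (a, b) | a <- mons N d, b <- mons N d] | P x.1 x.2 != 0].
have mem_supp x : (x \in supp) = (P x.1 x.2 != 0).
  rewrite mem_filter; case: (boolP (P x.1 x.2 != 0)) => //= /P_bounded/andP[x1 x2].
  by apply/allpairsP; exists x; rewrite !mem_mons x1 x2; case: x {x1 x2}.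
have supp_n0 : supp != [::].
  by apply/eqP => s0; have := mem_supp (a1, b1); rewrite s0 Pab1.
have [[a0 b0]] := seq_maximum exponent_le_total exponent_le_trans supp_n0.
rewrite mem_supp /= => Pab0 max0.
have {}max0 a b : P a b != 0 -> (a +m b0 <= a0 +m b)%O.
  by move=> Pab; apply: (max0 (a, b)); rewrite mem_supp.
pose fibre := [seq x <- supp | x.1 +m b0 == a0 +m x.2].
have fibre_n0 : fibre != [::].
  apply/eqP => s0; suff : (a0, b0) \in fibre by rewrite s0.
  by rewrite mem_filter eqxx mem_supp.
have ext i : exists x : multinom N * multinom N,
    [/\ P x.1 x.2 != 0, x.1 +m b0 = a0 +m x.2 &
        forall a b, P a b != 0 -> a +m b0 = a0 +m b -> (a (iota i) <= x.1 (iota i))%N].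
  pose r (x y : multinom N * multinom N) := (x.1 (iota i) <= y.1 (iota i))%N.
  have [||x] := @seq_maximum _ r fibre _ _ fibre_n0.
  - by move=> x y; exact: leq_total.
  - by move=> y x z; exact: leq_trans.
  rewrite mem_filter mem_supp => /andP[/eqP xf xs] xmax; exists x; split => // a b Pab ab.
  by apply: (xmax (a, b)); rewrite mem_filter mem_supp Pab andbT; apply/eqP.
have [x xP] := choice ext.
exists (fun i => (x i).1), (fun i => (x i).2); split=> [i|]; first by case: (xP i).
pose c i := (x i).1 +m e i; pose c' i := (x i).2 +m e i.
have cE i j : c i (iota j) = ((x i).1 (iota j) + (iota i == iota j))%N.
  by rewrite mnmDE mnm1E.
have fibreP i : (x i).1 +m b0 = a0 +m (x i).2 by case: (xP i).
(* Maximality of the degree in Z_i leaves a single term on the diagonal. *)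
have c_diag i : mul_form (c i) (c' i) != 0.
  rewrite /mul_form (bigD1 i) //= /c /c' !lem_addl !addmK big1 ?addr0.
    by rewrite mulf_neq0 //; case: (xP i).
  move=> j ji; case: ifP => [/andP[jc jc']|]; rewrite ?mulr0 //.
  apply/eqP; rewrite mulf_eq0 (negPf (eps_neq0 j)) /=; apply/negPn/negP => Pn.
  have [_ _ /(_ _ _ Pn)] := xP i.
  have -> : (c i -m e j) +m b0 = a0 +m (c' i -m e j).
    apply/mnmP => t; move/mnm_lepP/(_ t): jc; move/mnm_lepP/(_ t): jc'.
    have /mnmP/(_ t) := fibreP i; rewrite /c /c' !(mnmDE, mnmBE); lia.
  move=> /(_ erefl); rewrite mnmBE cE mnm1E eqxx inj_eq // (negPf ji); lia.
(* A nonzero entry comes from a monomial of P, whose weight is at most a0 - b0. *)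
have c_le i k : mul_form (c i) (c' k) != 0 -> (c i <= c k)%O.
  apply: contra_neqT => ik; rewrite /mul_form big1 // => j _.
  case: ifP => [/andP[jc jc']|]; rewrite ?mulr0 //.
  apply/eqP; rewrite mulf_eq0 (negPf (eps_neq0 j)) /=; apply: contraNT ik => /max0.
  rewrite -(lemc_add2r (e j)) => le_ik; rewrite -(lemc_add2r b0).
  suff [-> ->] : b0 +m c i = e j +m ((c i -m e j) +m b0) /\
                 b0 +m c k = e j +m (a0 +m (c' k -m e j)) by [].
  split; apply/mnmP => t; move/mnm_lepP/(_ t): jc; move/mnm_lepP/(_ t): jc'.
    by rewrite /c /c' !(mnmDE, mnmBE); lia.
  by have /mnmP/(_ t) := fibreP k; rewrite /c /c' !(mnmDE, mnmBE); lia.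
have c_inj : injective c.
  move=> i k ik; apply/eqP; apply: contraTT isT => ne.
  have /mnmP/(_ (iota i)) := ik; rewrite !cE eqxx inj_eq // [k == i]eq_sym (negPf ne).
  have [Pk _ _] := xP k; have [_ _ /(_ _ _ Pk (fibreP k))] := xP i; lia.
apply/eqP; rewrite -/(row_free _); apply: inj_row_free => v vM; apply/eqP.
apply: contraTT isT => v0.
pose s := [seq k <- enum 'I_n | v 0 k != 0].
have s0 : s != [::].
  apply: contra_neq v0 => s0; apply/rowP => k; rewrite mxE; apply/eqP.
  apply/negPn/negP => vk; have : k \in s by rewrite mem_filter vk mem_enum.
  by rewrite s0.
pose r (i k : 'I_n) := (c k <= c i)%O.
have [||k] := @seq_maximum _ r s _ _ s0.
- by move=> i k; exact: le_total.
- by move=> i k j ik ji; exact: le_trans ji ik.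
rewrite mem_filter => /andP[vk _] kmin.
have /rowP/(_ k) := vM; rewrite !mxE (bigD1 k) //= mxE big1 ?addr0.
  by move=> /eqP; rewrite mulf_eq0 (negPf vk) (negPf (c_diag k)).
move=> j jk; rewrite mxE; apply/eqP; rewrite mulf_eq0; apply: contraNT jk.
rewrite negb_or => /andP[vj /c_le cjk]; apply/eqP/c_inj/le_anti; rewrite cjk /=.
by apply: kmin; rewrite mem_filter vj mem_enum.
Qed.

End Huang.

(** * Inverses of series and of formal maps *)

Definition agree (K : Type) m d (f g : fps K m) := forall a, (mdeg a < d)%N -> f a = g a.

(** Each application of Phi makes two series agree one degree further, so the
    iterates of Phi stabilize in every degree. *)
Lemma fps_fixpoint (K : comNzRingType) m (Phi : fps K m -> fps K m) :
  (forall d f g, agree d f g -> agree d.+1 (Phi f) (Phi g)) -> exists f, Phi f = f.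
Proof.
move=> contr; pose F k := iter k Phi 0.
have Fagree k j : agree k (F k) (F (k + j)%N).
  elim: k => [|k IH] //; rewrite addSn /F !iterS; exact: contr.
exists (FPS (fun a => F (mdeg a).+1 a)); apply/fpsP => a.
transitivity (Phi (F (mdeg a)) a) => //; apply: (contr (mdeg a)) => // b ba.
by rewrite -[LHS]/(F (mdeg b).+1 b) -(subnKC ba); apply: Fagree.
Qed.

(** With f = c + h and h of positive order, g is the fixed point of
    g -> (1 - h g) / c. *)
Lemma fps_inverse (K : fieldType) m (f : fps K m) : f mnm0 != 0 -> exists g, f * g = 1.
Proof.
set c := f mnm0 => c0; pose h := f - c *: 1.
have [d g g' gg' a ad|g gP] :=
    @fps_fixpoint K m (fun g => c^-1 *: (1 - h * g)).
  rewrite !fcoefZ !fcoefB; congr (_ * (_ - _)); apply/eqP; rewrite -subr_eq0 -fcoefB -mulrBr.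
  apply/eqP; apply: fcoefM_eq0 => b e abe; rewrite [(g - g') e]fcoefB.
  have [->|b0] := eqVneq b mnm0; first by rewrite fcoefB fcoefZ fcoef1 eqxx mulr1 subrr mul0r.
  rewrite gg' ?subrr ?mulr0 //; move: ad b0; rewrite abe mdegD -mdeg_eq0; lia.
exists g; rewrite -[f](subrK (c *: 1)) -/h mulrDl -scalerAl mul1r -{2}gP scalerA divff //.
by rewrite scale1r addrC subrK.
Qed.

Section InverseFunction.
Variables (K : fieldType) (m : nat).
Implicit Types (f g : fps K m) (G H : 'rV[fps K m]_m).

Lemma comp_coef_mnm1 p (H : 'rV[fps K p]_m) (f : fps K m) i : (forall j, H 0 j mnm0 = 0) ->
  fps_comp f H (mnm1 i) = \sum_j f (mnm1 j) * H 0 j (mnm1 i).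
Proof.
move=> H0; rewrite (fcoef_comp H0 _ (ltnSn _)) mdeg1.
transitivity (\sum_(b <- [seq mnm1 j | j <- enum 'I_m]) f b * mon_subst H b (mnm1 i)).
  apply: eq_big_supp; rewrite ?mons_uniq //.
    by rewrite map_inj_uniq ?enum_uniq // => j k /eqP; rewrite eq_mnm1 => /eqP.
  move=> b; rewrite mem_mons => fb; have [|b2] := leqP (mdeg b) 1.
    rewrite leq_eqVlt ltnS => /orP[/mdeg1P[j /eqP ->]|].
      by rewrite mdeg1; apply/esym/mapP; exists j; rewrite ?mem_enum.
    rewrite leqn0 mdeg_eq0 => /eqP b0; move: fb.
    by rewrite b0 mon_subst0 fcoef1 mnm1_eq0 mulr0 eqxx.
  by move: fb; rewrite (order_mon_subst H0) ?mdeg1 // mulr0 eqxx.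
by rewrite big_map big_enum; apply: eq_bigr => j _; rewrite mon_subst1.
Qed.

(** Two series of order d with the same homogeneous part of degree d. *)
Definition tangent d f g := [/\ order_ge d f, order_ge d g & order_ge d.+1 (f - g)].

Lemma tangentM d e f f' g g' :
  tangent d f f' -> tangent e g g' -> tangent (d + e) (f * g) (f' * g').
Proof.
move=> [df df' dff'] [eg eg' egg']; split; try exact: order_geM.
have -> : f * g - f' * g' = f * (g - g') + (f - f') * g' by ring.
move=> a ad; rewrite fcoefD; have := order_geM df egg'; rewrite addnS => -> //.
by have := order_geM dff' eg'; rewrite addSn => -> //; rewrite addr0.
Qed.

Lemma tangent1 : tangent 0 1 1.
Proof. by split=> // a; rewrite subrr. Qed.

Lemma tangentX k f g : tangent 1 f g -> tangent k (f ^+ k) (g ^+ k).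
Proof.
move=> fg; elim: k => [|k IH]; first exact: tangent1.
by rewrite !exprS -add1n; apply: tangentM.
Qed.

Lemma mon_subst_tangent H : (forall i, tangent 1 (H 0 i) (fpsX K i)) ->
  forall b, tangent (mdeg b) (mon_subst H b) (monom K b).
Proof.
move=> HX b; rewrite -mon_subst_vars /mon_subst mdegE.
elim/big_rec3: _ => [|i k f g _ IH]; first exact: tangent1.
by apply: tangentM => //; apply: tangentX; rewrite fps_varsE.
Qed.

(** Substituting a map tangent to the identity changes f by terms of higher degree
    only, so y = f o H is the fixed point equation f = y - (f o H - f). *)
Lemma comp_tangent_surj H : (forall i, tangent 1 (H 0 i) (fpsX K i)) ->
  forall y, exists f, fps_comp f H = y.
Proof.
move=> HX y; have H0 i : H 0 i mnm0 = 0 by have [-> //] := HX i; rewrite mdeg0.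
have [d f g fg a ad|f fP] := @fps_fixpoint K m (fun f => y - (fps_comp f H - f)).
  rewrite !fcoefB; congr (_ - _); apply/eqP; rewrite -subr_eq0; apply/eqP.
  have -> : fps_comp f H a - f a - (fps_comp g H a - g a) =
    (fps_comp (f - g) H - (f - g)) a by rewrite (compB H0) !fcoefB; ring.
  rewrite fcoefB (fcoef_comp H0 _ (ltnSn _)) (bigD1_seq a) ?mons_uniq ?mem_mons //=.
  have [_ _ /(_ a (ltnSn _))] := mon_subst_tangent HX a.
  rewrite fcoefB /= eqxx => /eqP; rewrite subr_eq0 => /eqP ->; rewrite mulr1 addrAC subrr.
  rewrite add0r big_seq_cond big1 // => b /andP[]; rewrite mem_mons ltnS => ba bna.
  have [bd|db] := ltnP (mdeg b) d; first by rewrite fg ?subrr ?mul0r.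
  have [_ _ /(_ a)] := mon_subst_tangent HX b.
  rewrite fcoefB /= eq_sym (negPf bna) subr0 => -> //; [by rewrite mulr0 | lia].
exists f; move: fP; rewrite opprB addrA => /eqP; rewrite subr_eq addrC => /eqP /addrI ->.
by [].
Qed.

Definition jacobian0 H : 'M[K]_m := \matrix_(i, j) H 0 j (mnm1 i).

Lemma order_ge2P f : f mnm0 = 0 -> (forall i, f (mnm1 i) = 0) -> order_ge 2 f.
Proof.
move=> f0 f1 a; rewrite ltnS leq_eqVlt ltnS => /orP[/mdeg1P[j /eqP ->] //|].
by rewrite leqn0 mdeg_eq0 => /eqP ->.
Qed.

(** Composing with the inverse of the linear part reduces to a map tangent to the
    identity. *)
Lemma formal_left_inverse H : (forall i, H 0 i mnm0 = 0) -> jacobian0 H \in unitmx ->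
  exists G, (forall i, G 0 i mnm0 = 0) /\ map_mx (fun f => fps_comp f H) G = fps_vars K m.
Proof.
move=> H0 JH; pose V := invmx (jacobian0 H).
pose L : 'rV[fps K m]_m := \row_k \sum_j V j k *: fpsX K j.
have L0 i : L 0 i mnm0 = 0.
  rewrite mxE fcoef_sum big1 // => j _; rewrite fcoefZ -fps_varsE fps_vars_nct mulr0 //.
pose H' := map_mx (fun f => fps_comp f H) L.
have H'E k : H' 0 k = \sum_j V j k *: H 0 j.
  rewrite !mxE (comp_sum H0); apply: eq_bigr => j _.
  by rewrite (compZ H0) (compX H0).
have H'X i : tangent 1 (H' 0 i) (fpsX K i).
  have H'0 : H' 0 i mnm0 = 0 by rewrite mxE comp_coef0.
  have X0 : fpsX K i mnm0 = 0 by rewrite -fps_varsE fps_vars_nct.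
  split; try exact/order_ge1P; apply: order_ge2P; first by rewrite fcoefB H'0 X0 subrr.
  move=> j; rewrite fcoefB H'E fcoef_sum.
  have /matrixP/(_ j i) := mulmxV JH; rewrite !mxE => VJ.
  apply/eqP; rewrite subr_eq0; apply/eqP; rewrite /= eq_mnm1 -VJ.
  by apply: eq_bigr => k _; rewrite mxE mulrC.
have [G' G'P] := choice (fun i => comp_tangent_surj H'X (fpsX K i)).
have H'0 i : H' 0 i mnm0 = 0 by rewrite mxE comp_coef0.
pose G : 'rV[fps K m]_m := map_mx (fun f => fps_comp f L) (\row_i G' i).
exists G; split=> [i|].
  by rewrite !mxE comp_coef0 // -(comp_coef0 H'0) G'P -fps_varsE fps_vars_nct.
by apply/rowP => i; rewrite !mxE comp_assoc // G'P.
Qed.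

Lemma jacobian0_comp G H : (forall i, H 0 i mnm0 = 0) ->
  jacobian0 (map_mx (fun f => fps_comp f H) G) = jacobian0 H *m jacobian0 G.
Proof.
move=> H0; apply/matrixP => i k; rewrite !mxE comp_coef_mnm1 //.
by apply: eq_bigr => j _; rewrite !mxE mulrC.
Qed.

Lemma jacobian0_vars : jacobian0 (fps_vars K m) = 1%:M.
Proof. by apply/matrixP => i k; rewrite !mxE /= eq_mnm1. Qed.

Lemma comp_map_assoc (F G H : 'rV[fps K m]_m) :
  (forall i, G 0 i mnm0 = 0) -> (forall i, H 0 i mnm0 = 0) ->
  map_mx (fun f => fps_comp f H) (map_mx (fun f => fps_comp f G) F) =
  map_mx (fun f => fps_comp f (map_mx (fun g => fps_comp g H) G)) F.
Proof. by move=> G0 H0; apply/rowP => i; rewrite !mxE comp_assoc. Qed.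

(** Left inverses suffice: a left inverse G of H has itself a left inverse F, and
    F = F o (G o H) = (F o G) o H = H. *)
Lemma formal_inverse H : (forall i, H 0 i mnm0 = 0) -> jacobian0 H \in unitmx ->
  exists G, [/\ forall i, G 0 i mnm0 = 0,
    map_mx (fun f => fps_comp f H) G = fps_vars K m &
    map_mx (fun f => fps_comp f G) H = fps_vars K m].
Proof.
move=> H0 JH; have [G [G0 GH]] := formal_left_inverse H0 JH.
have JG : jacobian0 G \in unitmx.
  have := jacobian0_comp G H0; rewrite GH jacobian0_vars => JJ.
  by have [] := mulmx1_unit (esym JJ).
have [F [F0 FG]] := formal_left_inverse G0 JG.
exists G; split=> //; suff <- : F = H by [].
have := comp_map_assoc F G0 H0; rewrite FG GH comp_vars_map // => ->.
by apply/rowP => i; rewrite mxE comp_vars.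
Qed.

End InverseFunction.

(** * The equation of a map between two hypersurfaces *)

Lemma fcoefMX (K : comNzRingType) m (f : fps K m) i a :
  (f * fpsX K i) a = f (a -m mnm1 i) *+ (a i != 0%N).
Proof.
have [ai|] := boolP (a i != 0%N).
  have ia : mnm1 i <=m a by rewrite lep1mP.
  rewrite -{1}(submK ia) fcoefM_single /= ?eqxx ?mulr1 // => b c bne e.
  have [ci|] := eqVneq c (mnm1 i); last by rewrite mulr0.
  by move: bne; rewrite ci in e; rewrite -(addIm e) eqxx.
rewrite negbK => /eqP ai; apply: fcoefM_eq0 => b c abc /=.
have [ci|] := eqVneq c (mnm1 i); last by rewrite mulr0.
by move: ai; rewrite abc mnmDE ci mnm1E eqxx addn1.
Qed.

Lemma fcoefMXS (K : comNzRingType) m (f : fps K m) i a :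
  (f * fpsX K i) (a +m mnm1 i) = f a.
Proof. by rewrite fcoefMX addmK mnmDE mnm1E eqxx addn1 mulr1n. Qed.

Lemma cf_MX (K : comNzRingType) N (A : fps K (N + N)) i a b :
  cf (A * fpsX K (lshift N i)) a b = cf A (a -m mnm1 i) b *+ (a i != 0%N).
Proof.
rewrite /cf fcoefMX mcatl; congr (A _ *+ _); apply/mnmP => j.
rewrite mnmBE mnm1_lshift -(splitK j); case: (fintype.split j) => k /=.
  by rewrite !mcatl mnmBE.
by rewrite !mcatr mnm0E subn0.
Qed.

Lemma cf_MXbar (K : comNzRingType) N (A : fps K (N + N)) i a b :
  cf (A * fpsX K (rshift N i)) a b = cf A a (b -m mnm1 i) *+ (b i != 0%N).
Proof.
rewrite /cf fcoefMX mcatr; congr (A _ *+ _); apply/mnmP => j.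
rewrite mnmBE mnm1_rshift -(splitK j); case: (fintype.split j) => k /=.
  by rewrite !mcatl mnm0E subn0.
by rewrite !mcatr mnmBE.
Qed.

Section Rigidity.
Variables (R : realType) (n l : nat).
Local Notation C := R[i].
Local Notation N := (n + 1)%N.
Implicit Types (A : fps C (N + N)) (a b : multinom N) (H : 'rV[fps C N]_N).

(** The indices of the coordinates z_j and w of Z = (z, w). *)
Definition zi (j : 'I_n) : 'I_N := lshift 1 j.
Definition wi : 'I_N := rshift n ord0.

Definition levi_sign (j : 'I_n) : C := if (j < l)%N then -1 else 1.

Lemma levi_sign_neq0 j : levi_sign j != 0.
Proof. by rewrite /levi_sign; case: ifP; rewrite ?oppr_eq0 oner_eq0. Qed.

Lemma conj_levi_sign j : (levi_sign j)^* = levi_sign j.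
Proof. by rewrite /levi_sign; case: ifP; rewrite ?rmorphN rmorph1. Qed.

Lemma lformE (K : lalgType C) (x y : 'rV[K]_n) :
  lform l x y = \sum_j levi_sign j *: (x 0 j * y 0 j).
Proof.
rewrite /lform [RHS](bigID (fun j : 'I_n => (j < l)%N)) /=; congr (_ + _).
  by rewrite -sumrN; apply: eq_bigr => j jl; rewrite /levi_sign jl scaleN1r.
rewrite (eq_bigl (fun j : 'I_n => ~~ (j < l)%N)); last by move=> j; rewrite -leqNgt.
by apply: eq_bigr => j /negPf jl; rewrite /levi_sign jl scale1r.
Qed.

Lemma fdefiningE A : fdefining l A =
  (2 * 'i)^-1 *: (fpsX C (lshift N wi) - fpsX C (rshift N wi))
  - (\sum_j levi_sign j *: (fpsX C (lshift N (zi j)) * fpsX C (rshift N (zi j)))) - A.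
Proof.
rewrite /fdefining lformE /wcoord /zcoord; congr (_ - _ - _).
  by rewrite !mxE.
by apply: eq_bigr => j _; rewrite !mxE.
Qed.

Lemma comp_bar_fdefining A H : no_constant_term H -> comp_bar (fdefining l A) H =
  (2 * 'i)^-1 *: (holo (H 0 wi) - fps_conj (holo (H 0 wi)))
  - (\sum_j levi_sign j *: (holo (H 0 (zi j)) * fps_conj (holo (H 0 (zi j)))))
  - comp_bar A H.
Proof.
move=> H0; rewrite fdefiningE /comp_bar; have G0 := comp_bar_nct H0.
rewrite !(compB G0) (compZ G0) (compB G0) !(compX G0) (comp_sum G0).
rewrite row_mxEl row_mxEr !mxE; congr (_ - _ - _); apply: eq_bigr => j _.
by rewrite (compZ G0) (compM G0) !(compX G0) row_mxEl row_mxEr !mxE.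
Qed.

Lemma conj_2i : ((2 * 'i : C)^-1)^* = - (2 * 'i)^-1.
Proof. by rewrite fmorphV rmorphM /= conjCi rmorph_nat mulrN invrN. Qed.

Lemma fps_conjXl i : fps_conj (fpsX C (lshift N i)) = fpsX C (rshift N i).
Proof.
have /(congr1 (@fps_conj R N)) := holoX R i; rewrite conj_holoX.
by rewrite !mxE => <-.
Qed.

Lemma fps_conjXr i : fps_conj (fpsX C (rshift N i)) = fpsX C (lshift N i).
Proof. by rewrite -fps_conjXl fps_conjK. Qed.

Lemma conj_fdefining A : fps_conj A = A -> fps_conj (fdefining l A) = fdefining l A.
Proof.
move=> AA; rewrite fdefiningE !fps_conjB AA fps_conjZ conj_2i fps_conjB fps_conjXl fps_conjXr.
rewrite scaleNr -scalerN opprB fps_conj_sum; congr (_ - _ - _); apply: eq_bigr => j _.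
by rewrite fps_conjZ conj_levi_sign fps_conjM fps_conjXl fps_conjXr mulrC.
Qed.

Lemma conj_comp_bar_fdefining A H : no_constant_term H -> fps_conj A = A ->
  fps_conj (comp_bar (fdefining l A) H) = comp_bar (fdefining l A) H.
Proof. by move=> H0 AA; rewrite conj_comp_bar // conj_fdefining. Qed.

Lemma at_Zbar0M A B : at_Zbar0 (A * B : fps C (N + N)) = at_Zbar0 A * at_Zbar0 B.
Proof. by rewrite /at_Zbar0 compM //; exact: at_Zbar0_nct. Qed.

Lemma at_Zbar0Z c A : at_Zbar0 (c *: A) = c *: at_Zbar0 A.
Proof. by rewrite /at_Zbar0 compZ //; exact: at_Zbar0_nct. Qed.

Lemma at_Zbar0_holo (F : fps C N) : at_Zbar0 (holo F) = F.
Proof. by apply/fpsP => a; rewrite at_Zbar0E cf_holo eqxx. Qed.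

Lemma at_Zbar0_conj_holo (F : fps C N) : at_Zbar0 (fps_conj (holo F)) = (F mnm0)^* *: 1.
Proof.
by apply/fpsP => a; rewrite at_Zbar0E cf_conj_holo fcoefZ fcoef1; case: eqP; rewrite ?mulr1 ?mulr0.
Qed.

Lemma at_Zbar0_fdefining A : bi_order_ge2 A ->
  at_Zbar0 (fdefining l A) = (2 * 'i)^-1 *: fpsX C wi.
Proof.
move=> A2; apply/fpsP => a; rewrite at_Zbar0E fdefiningE !cfB cfZ cfB cf_sum.
rewrite (A2 a mnm0) ?mdeg0 ?orbT // subr0 big1 ?subr0; last first.
  move=> j _; rewrite cfZ cf_MXbar mnm0E eqxx mulr0n mulr0 //.
rewrite /cf /= mnm1_lshift mnm1_rshift !mcat_eq eqxx andbT.
by rewrite [_ == mnm1 wi :> multinom _ in X in _ - X]eq_sym mnm1_eq0 andbF subr0.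
Qed.

Lemma at_Zbar0_comp_bar_fdefining A H : no_constant_term H -> bi_order_ge2 A ->
  at_Zbar0 (comp_bar (fdefining l A) H) = (2 * 'i)^-1 *: H 0 wi.
Proof.
move=> H0 A2; have A2H := bi_order_comp_bar H0 A2.
apply/fpsP => a; rewrite at_Zbar0E comp_bar_fdefining // !cfB cfZ cfB cf_sum.
have A2H0 : cf (comp_bar A H) a mnm0 = 0 by apply: A2H; rewrite mdeg0 orbT.
rewrite [X in _ - X]A2H0 subr0 big1 ?subr0; last first.
  by move=> j _; rewrite cfZ cf_holo_conj H0 rmorph0 !mulr0.
by rewrite cf_holo cf_conj_holo H0 rmorph0 mul0rn subr0 eqxx fcoefZ.
Qed.

Lemma two_i_neq0 : (2 * 'i : C)^-1 != 0.
Proof. by rewrite invr_eq0 mulf_neq0 ?pnatr_eq0 // neq0Ci. Qed.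

(** At Zbar = 0 the equation reads g(Z) = G(Z, 0) w, since the form, A1 and A2 all
    vanish there. The conjugate equation gives the same relation with the conjugate
    of G(0, Zbar), and w cancels. *)
Lemma sends_normal_component A1 A2 H : no_constant_term H ->
  bi_order_ge2 A1 -> bi_order_ge2 A2 -> fps_conj A1 = A1 -> fps_conj A2 = A2 ->
  sends H (fdefining l A1) (fdefining l A2) ->
  exists (G : fps C (N + N)),
    [/\ comp_bar (fdefining l A2) H = G * fdefining l A1,
        H 0 wi = at_Zbar0 G * fpsX C wi &
        at_Zbar0 (fps_conj G) = at_Zbar0 G].
Proof.
move=> H0 A12 A22 A1r A2r [G GE]; exists G.
have comp1 : H 0 wi = at_Zbar0 G * fpsX C wi.
  apply: (scalerI two_i_neq0); rewrite -(at_Zbar0_comp_bar_fdefining H0 A22) GE.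
  by rewrite at_Zbar0M at_Zbar0_fdefining // -scalerAr.
have comp2 : H 0 wi = at_Zbar0 (fps_conj G) * fpsX C wi.
  apply: (scalerI two_i_neq0); rewrite -(at_Zbar0_comp_bar_fdefining H0 A22).
  rewrite -(conj_comp_bar_fdefining H0 A2r) GE.
  by rewrite fps_conjM conj_fdefining // at_Zbar0M at_Zbar0_fdefining // -scalerAr.
split=> //; apply/fpsP => a; move: comp2; rewrite comp1 => /fpsP/(_ (a +m mnm1 wi)).
by rewrite !fcoefMXS.
Qed.

End Rigidity.

(** * The first-order part of the normalized equation *)

Section FirstOrder.
Variables (R : realType) (n l : nat).
Local Notation C := R[i].
Local Notation N := (n + 1)%N.
Local Notation zi := (@zi n).
Local Notation wi := (@wi n).
Local Notation sgn := (@levi_sign R n l).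
Local Notation conjv := (map_mx Num.conj).

Lemma lformCE (x y : 'rV[C]_n) : lform l x y = \sum_j sgn j * (x 0 j * y 0 j).
Proof.
rewrite /lform [RHS](bigID (fun j : 'I_n => (j < l)%N)) /=; congr (_ + _).
  by rewrite -sumrN; apply: eq_bigr => j jl; rewrite /levi_sign jl mulN1r.
rewrite (eq_bigl (fun j : 'I_n => ~~ (j < l)%N)); last by move=> j; rewrite -leqNgt.
by apply: eq_bigr => j /negPf jl; rewrite /levi_sign jl mul1r.
Qed.

Definition levi_mx : 'M[C]_n := diag_mx (\row_k sgn k).

Lemma zi_neq_wi j : (zi j == wi) = false.
Proof. exact: eq_lrshift. Qed.

Lemma zi_inj : injective zi.
Proof. exact: lshift_inj. Qed.

Lemma levi_row m (x : 'rV[C]_n) (y : 'M[C]_(m, n)) j :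
  (x *m (levi_mx *m (conjv y)^T)) 0 j = \sum_k sgn k * (x 0 k * (y j k)^*).
Proof.
rewrite mulmxA mul_mx_diag !mxE; apply: eq_bigr => k _; rewrite !mxE; ring.
Qed.

Lemma lform_conj_mx (x y : 'rV[C]_n) :
  lform l x (conjv y) = (x *m (levi_mx *m (conjv y)^T)) 0 0.
Proof. by rewrite levi_row lformCE; apply: eq_bigr => k _; rewrite !mxE. Qed.

Variables (c : C) (q : fps C N) (F : 'I_n -> fps C N).

(** The terms of bidegree (1, 1) in (Z, Zbar) of the normalized equation below:
    the linear parts of q and F multiply the Hermitian form of the hyperquadric
    by c. *)
Definition first_order_isometry := forall i j,
  (2 * 'i)^-1 * ((i == wi)%:R * (q (mnm1 j))^* - q (mnm1 i) * (j == wi)%:R)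
  - c^-1 * (\sum_k sgn k * (F k (mnm1 i) * (F k (mnm1 j))^*))
  = - (\sum_k sgn k * ((i == zi k) && (j == zi k))%:R).

Definition jac_z : 'M[C]_n := \matrix_(i, k) F k (mnm1 (zi i)).

Hypothesis c_neq0 : c != 0.
Hypothesis isom : first_order_isometry.

(** The case of two indices among those of z. *)
Lemma jac_z_levi : jac_z *m (levi_mx *m (conjv jac_z)^T) = c *: levi_mx.
Proof.
apply/row_matrixP => i; rewrite row_mul; apply/rowP => j; rewrite levi_row.
have := isom (zi i) (zi j); rewrite !zi_neq_wi mulr0 mul0r subrr mulr0 sub0r.
move=> /oppr_inj/(canRL (mulVKf c_neq0)).
move=> e; under eq_bigr do rewrite !mxE.
rewrite e !mxE; congr (c * _).
rewrite (bigD1 i) //= big1 ?addr0; last first.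
  by move=> k ki; rewrite (inj_eq zi_inj) eq_sym (negPf ki) mulr0.
by rewrite eqxx /= (inj_eq zi_inj) eq_sym mulr_natr.
Qed.

Lemma jac_z_unit : (jac_z \in unitmx) && (levi_mx *m (conjv jac_z)^T \in unitmx).
Proof.
rewrite -unitmx_mul jac_z_levi unitmxZ ?unitfE //.
rewrite unitmxE det_diag unitfE; apply/prodf_neq0 => i _.
by rewrite mxE levi_sign_neq0.
Qed.

Lemma lform_jac_z (x y : 'rV[C]_n) :
  lform l (x *m jac_z) (conjv (y *m jac_z)) = c * lform l x (conjv y).
Proof.
rewrite !lform_conj_mx map_mxM trmx_mul.
have -> : x *m jac_z *m (levi_mx *m ((conjv jac_z)^T *m (conjv y)^T)) =
    x *m (jac_z *m (levi_mx *m (conjv jac_z)^T)) *m (conjv y)^T by rewrite !mulmxA.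
by rewrite jac_z_levi -scalemxAr -scalemxAl mxE mulmxA.
Qed.

End FirstOrder.

(** * Rigidity of the normalized equation *)

Section Core.
Variables (R : realType) (n l : nat).
Local Notation C := R[i].
Local Notation N := (n + 1)%N.
Local Notation zi := (@zi n).
Local Notation wi := (@wi n).
Local Notation sgn := (@levi_sign R n l).
Implicit Types (A : fps C (N + N)) (a b : multinom N) (H : 'rV[fps C N]_N).

(* The normalized equation. *)
(* The equation of a map, multiplied by a factor of rank one so that the remaining
   factor 1 + G' equals 1 at Z = 0 and at Zbar = 0. Here A2 stands for the series
   into which the second one is transformed. *)
Variables (A1 A2 G' : fps C (N + N)) (q : fps C N) (F : 'I_n -> fps C N) (c : C).
Hypothesis c_neq0 : c != 0.
Hypothesis A1_order : bi_order_ge2 A1.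
Hypothesis A2_order : bi_order_ge2 A2.
Hypothesis G'_order : forall a b, (a == mnm0) || (b == mnm0) -> cf G' a b = 0.
Hypothesis normalized :
  (2 * 'i)^-1 *: (fpsX C (lshift N wi) * fps_conj (holo q) - holo q * fpsX C (rshift N wi))
  - c^-1 *: (\sum_j sgn j *: (holo (F j) * fps_conj (holo (F j)))) - A2
  = (1 + G') * fdefining l A1.

Lemma cf_G'A1_eq0 a b : ((mdeg a <= 2) || (mdeg b <= 2))%N -> cf (G' * A1) a b = 0.
Proof.
move=> ab; apply: cfM_eq0 => a1 a2 b1 b2 ea eb.
have [a10|a10] := eqVneq a1 mnm0; first by rewrite G'_order ?a10 ?eqxx ?mul0r.
have [b10|b10] := eqVneq b1 mnm0; first by rewrite G'_order ?b10 ?eqxx ?orbT ?mul0r.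
rewrite A1_order ?mulr0 //; move: ab a10 b10; rewrite ea eb !mdegD -!mdeg_eq0; lia.
Qed.

Local Notation M := (mul_form zi sgn (cf G')).

Lemma cf_G'_levi a b :
  cf (G' * \sum_j sgn j *: (fpsX C (lshift N (zi j)) * fpsX C (rshift N (zi j)))) a b = M a b.
Proof.
rewrite mulr_sumr cf_sum; apply: eq_bigr => j _.
rewrite -scalerAr cfZ mulrA cf_MXbar cf_MX !lep1mP; congr (_ * _).
by do 2!case: (_ != _).
Qed.

Lemma normalized_coef a b : a != mnm0 -> b != mnm0 ->
  (2 * 'i)^-1 * ((a == mnm1 wi)%:R * (q b)^* - q a * (b == mnm1 wi)%:R)
  - c^-1 * (\sum_j sgn j * (F j a * (F j b)^*)) - cf A2 a b
  = - (\sum_j sgn j * ((a == mnm1 (zi j)) && (b == mnm1 (zi j)))%:R) - cf A1 a b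
    + (2 * 'i)^-1 * (cf G' (a -m mnm1 wi) b *+ (a wi != 0%N)
                     - cf G' a (b -m mnm1 wi) *+ (b wi != 0%N))
    - M a b - cf (G' * A1) a b.
Proof.
move=> a0 b0; have := congr1 (fun A => cf A a b) normalized.
rewrite fdefiningE [(1 + G') * _]mulrDl [1 * _]mul1r.
have -> : G' * ((2 * 'i)^-1 *: (fpsX C (lshift N wi) - fpsX C (rshift N wi)) -
        \sum_j sgn j *: (fpsX C (lshift N (zi j)) * fpsX C (rshift N (zi j))) - A1) =
   (2 * 'i)^-1 *: (G' * fpsX C (lshift N wi) - G' * fpsX C (rshift N wi)) -
        G' * (\sum_j sgn j *: (fpsX C (lshift N (zi j)) * fpsX C (rshift N (zi j)))) - G' * A1.
  by rewrite !mulrBr -scalerAr mulrBr.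
rewrite !cfB cfD !cfB !cfZ !cfB cf_G'_levi !cf_sum.
rewrite [cf (G' * fpsX C (lshift _ _)) a b]cf_MX [cf (G' * fpsX C (rshift _ _)) a b]cf_MXbar.
have -> : fpsX C (lshift N wi) = holo (fpsX C wi) by rewrite holoX !mxE.
have -> : fpsX C (rshift N wi) = fps_conj (holo (fpsX C wi)) by rewrite conj_holoX !mxE.
rewrite !cf_holo_conj cf_holo cf_conj_holo (negPf a0) (negPf b0) !mulr0n subrr mulr0 sub0r.
have -> : \sum_j cf (sgn j *: (holo (F j) * fps_conj (holo (F j)))) a b =
          \sum_j sgn j * (F j a * (F j b)^*).
  by apply: eq_bigr => j _; rewrite cfZ cf_holo_conj.
have -> : \sum_j cf (sgn j *: (fpsX C (lshift N (zi j)) * fpsX C (rshift N (zi j)))) a b =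
          \sum_j sgn j * ((a == mnm1 (zi j)) && (b == mnm1 (zi j)))%:R.
  apply: eq_bigr => j _; rewrite cfZ; congr (_ * _).
  have -> : fpsX C (lshift N (zi j)) = holo (fpsX C (zi j)) by rewrite holoX !mxE.
  have -> : fpsX C (rshift N (zi j)) = fps_conj (holo (fpsX C (zi j))).
    by rewrite conj_holoX !mxE.
  by rewrite cf_holo_conj /= rmorph_nat -natrM mulnb.
rewrite /= rmorph_nat => ->; ring.
Qed.

Lemma cf_A_linear A a i : bi_order_ge2 A -> cf A a (mnm1 i) = 0.
Proof. by move=> A2'; rewrite A2' ?mdeg1 ?orbT. Qed.

Lemma M_linear a i : M a (mnm1 i) = 0.
Proof.
rewrite /mul_form big1 // => j _; case: ifP; rewrite ?mulr0 // => /andP[_ ji].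
have := congr1 (@mdeg _) (submK ji); rewrite mdegD !mdeg1 addn1 => - [/eqP].
by rewrite mdeg_eq0 => ij0; rewrite G'_order ?ij0 ?orbT ?mulr0.
Qed.

Lemma G'_linear a i j : cf G' a (mnm1 i -m mnm1 j) *+ (mnm1 i j != 0%N) = 0.
Proof.
rewrite mnm1E; have [->|_] := eqVneq i j; last by rewrite mulr0n.
by rewrite G'_order ?mul0rn // (_ : mnm1 j -m mnm1 j = mnm0) ?eqxx ?orbT //;
  apply/mnmP => k; rewrite mnmBE mnm0E subnn.
Qed.

Lemma G'_linear_l b i j : cf G' (mnm1 i -m mnm1 j) b *+ (mnm1 i j != 0%N) = 0.
Proof.
rewrite mnm1E; have [->|_] := eqVneq i j; last by rewrite mulr0n.
by rewrite G'_order ?mul0rn // (_ : mnm1 j -m mnm1 j = mnm0) ?eqxx ?orbT //;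
  apply/mnmP => k; rewrite mnmBE mnm0E subnn.
Qed.

Lemma mnm1_neq0 i : mnm1 i != mnm0 :> multinom N.
Proof. by rewrite mnm1_eq0. Qed.

Lemma bidegree11 : first_order_isometry l c q F.
Proof.
move=> i j; have := normalized_coef (mnm1_neq0 i) (mnm1_neq0 j).
rewrite [cf A2 _ _]cf_A_linear // [cf A1 _ _]cf_A_linear // (M_linear (mnm1 i) j).
rewrite G'_linear G'_linear_l cf_G'A1_eq0 ?mdeg1 //.
rewrite !subr0 mulr0 addr0 !eq_mnm1 => ->; congr (- _); apply: eq_bigr => k _.
by rewrite !eq_mnm1.
Qed.

Lemma bidegree_a1 a i : (2 <= mdeg a)%N ->
  - (2 * 'i)^-1 * q a * (i == wi)%:R
  - c^-1 * (\sum_k sgn k * (F k a * (F k (mnm1 i))^*))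
  = (2 * 'i)^-1 * (cf G' (a -m mnm1 wi) (mnm1 i) *+ (a wi != 0%N)).
Proof.
move=> a2; have a0 : a != mnm0 by rewrite -mdeg_eq0; lia.
have an1 j : (a == mnm1 j) = false.
  by apply/eqP => e; move: a2; rewrite e mdeg1.
have s0 : \sum_j sgn j * ((a == mnm1 (zi j)) && (mnm1 i == mnm1 (zi j)))%:R = 0.
  by apply: big1 => j _; rewrite an1 mulr0.
have := normalized_coef a0 (mnm1_neq0 i); rewrite s0.
rewrite [cf A2 _ _]cf_A_linear // [cf A1 _ _]cf_A_linear // (M_linear a i).
rewrite G'_linear cf_G'A1_eq0 ?mdeg1 ?orbT // an1 eq_mnm1.
rewrite !subr0 oppr0 add0r mul0r sub0r => <-; ring.
Qed.

(** By the invertibility of the Jacobian of F in z, the terms of bidegree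
    (a, zbar_j) express the coefficients of F through those of w G'. *)
Lemma bidegree_a1_zero a : (2 <= mdeg a)%N ->
  (forall j, cf G' (a -m mnm1 wi) (mnm1 (zi j)) *+ (a wi != 0%N) = 0) ->
  forall k, F k a = 0.
Proof.
move=> a2 Ga; pose x : 'rV[C]_n := \row_k F k a.
suff x0 : x = 0 by move=> k; have /rowP/(_ k) := x0; rewrite !mxE.
have /andP[_ LU] := jac_z_unit c_neq0 bidegree11; apply: (can_inj (mulmxK LU)); rewrite mul0mx.
apply/rowP => j; rewrite levi_row mxE.
have := bidegree_a1 (zi j) a2; rewrite Ga zi_neq_wi !mulr0 sub0r => /eqP.
rewrite oppr_eq0 mulf_eq0 invr_eq0 (negPf c_neq0) /= => /eqP e.
by rewrite -[RHS]e; apply: eq_bigr => k _; rewrite !mxE.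
Qed.

(** Weight 1 for z and 3 for w. With the weight 3 instead of the usual 2, the
    factor w raises the weight more than the Levi form does, and the part of lowest
    weight of G' times the defining series is minus G' times the Levi form. *)
Definition wt a := (mdeg a + 2 * a wi)%N.

Lemma wtD a b : wt (a +m b) = (wt a + wt b)%N.
Proof. rewrite /wt mdegD mnmDE; lia. Qed.

Lemma wt_zi j : wt (mnm1 (zi j)) = 1%N.
Proof. by rewrite /wt mdeg1 mnm1E zi_neq_wi. Qed.

Lemma wt_wi : wt (mnm1 wi) = 3.
Proof. by rewrite /wt mdeg1 mnm1E eqxx. Qed.

Lemma mdeg_le_wt a : (mdeg a <= wt a)%N.
Proof. exact: leq_addr. Qed.

Lemma wtB a i : a i != 0%N -> (wt (a -m mnm1 i) + wt (mnm1 i))%N = wt a.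
Proof. by move=> ai; rewrite -wtD submK // lep1mP. Qed.

Variables k1 k2 : nat.
Hypothesis A1_rank : rank_le k1 A1.
Hypothesis A2_rank : rank_le k2 A2.
Hypothesis k_lt_n : (k1 + k2 < n)%N.

Section Step.
Variable m : nat.
Hypothesis G'_small : forall a b, (wt a + wt b < m)%N -> cf G' a b = 0.

(** All the coefficients of G' that determine this one are of weight less than m. *)
Lemma F_small a k : (2 <= mdeg a)%N -> (wt a < m + 2)%N -> F k a = 0.
Proof.
move=> a2 am; apply: bidegree_a1_zero => // j.
have [aw|] := boolP (a wi != 0%N); last by rewrite mulr0n.
rewrite G'_small ?mul0rn // wt_zi; have := wtB aw; rewrite wt_wi; lia.
Qed.

(** In the weight m + 2, only three terms survive. The nonlinear parts of F are
    multiples of w G', so their products are of weight at least 2 m + 4; w G' is of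
    weight at least m + 3, and A1 is of weight at least 4 because each of its
    monomials is of degree at least 2 in Z and in Zbar. *)
Lemma leading_coef a b : (2 <= mdeg a)%N -> (2 <= mdeg b)%N -> (wt a + wt b = m + 2)%N ->
  M a b = cf (A2 - A1) a b.
Proof.
move=> a2 b2 abm; have a0 : a != mnm0 by rewrite -mdeg_eq0; lia.
have b0 : b != mnm0 by rewrite -mdeg_eq0; lia.
have an1 j : (a == mnm1 j) = false by apply/eqP => e; move: a2; rewrite e mdeg1.
have bn1 j : (b == mnm1 j) = false by apply/eqP => e; move: b2; rewrite e mdeg1.
have Fab : \sum_j sgn j * (F j a * (F j b)^*) = 0.
  apply: big1 => j _; rewrite F_small ?mul0r ?mulr0 //.
  by have := mdeg_le_wt b; lia.
have s0 : \sum_j sgn j * ((a == mnm1 (zi j)) && (b == mnm1 (zi j)))%:R = 0.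
  by apply: big1 => j _; rewrite an1 mulr0.
have Ga : cf G' (a -m mnm1 wi) b *+ (a wi != 0%N) = 0.
  have [aw|] := boolP (a wi != 0%N); last by rewrite mulr0n.
  by rewrite G'_small ?mul0rn //; have := wtB aw; rewrite wt_wi; lia.
have Gb : cf G' a (b -m mnm1 wi) *+ (b wi != 0%N) = 0.
  have [bw|] := boolP (b wi != 0%N); last by rewrite mulr0n.
  by rewrite G'_small ?mul0rn //; have := wtB bw; rewrite wt_wi; lia.
have GA : cf (G' * A1) a b = 0.
  apply: cfM_eq0 => a1 a2' b1 b2' ea eb.
  have [|a2'2] := ltnP (mdeg a2') 2; first by move=> h; rewrite A1_order ?h ?mulr0.
  have [|b2'2] := ltnP (mdeg b2') 2; first by move=> h; rewrite A1_order ?h ?orbT ?mulr0.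
  rewrite G'_small ?mul0r //; move: abm; rewrite ea eb !wtD.
  by have := mdeg_le_wt a2'; have := mdeg_le_wt b2'; lia.
have := normalized_coef a0 b0.
rewrite Fab s0 Ga Gb GA an1 bn1 => /eqP; rewrite -subr_eq0 => /eqP e.
by apply/eqP; rewrite -subr_eq0; apply/eqP; rewrite -[RHS]e cfB /=; ring.
Qed.

(** A nonzero part of G', of fixed weight in Z and in Zbar, would by Huang's lemma
    give a submatrix of A2 - A1 of rank n, more than k1 + k2. The two weights have
    to be fixed separately so that the chosen rows and columns all meet in the
    weight m + 2. *)
Lemma G'_step a b : (wt a + wt b = m)%N -> cf G' a b = 0.
Proof.
move=> abm; apply/eqP/negPn/negP => Gab.
pose P a' b' := if (wt a' == wt a) && (wt b' == wt b) then cf G' a' b' else 0.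
have Pb a' b' : P a' b' != 0 -> (mdeg a' < m.+1)%N && (mdeg b' < m.+1)%N.
  rewrite /P; case: ifP; rewrite ?eqxx // => /andP[/eqP wa /eqP wb] _.
  by have := mdeg_le_wt a'; have := mdeg_le_wt b'; lia.
have PP : exists a b, P a b != 0 by exists a, b; rewrite /P !eqxx.
have [mu [nu [Pmn rk]]] := huang_submatrix (@zi_inj n) (@levi_sign_neq0 R n l) Pb PP.
have := rank_leB A2_rank A1_rank (fun i => mu i +m mnm1 (zi i)) (fun i => nu i +m mnm1 (zi i)).
rewrite leqNgt => /negP; apply; rewrite [(k2 + k1)%N]addnC.
apply: (leq_trans k_lt_n); rewrite -{1}rk; apply: eq_leq; congr (\rank _).
apply/matrixP => i j; rewrite !mxE.
have := Pmn i; rewrite /P; case: ifP; rewrite ?eqxx // => /andP[/eqP wmu _] Gi.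
have := Pmn j; rewrite /P; case: ifP; rewrite ?eqxx // => /andP[_ /eqP wnu] Gj.
have mu0 : mu i != mnm0 by apply: contraNneq Gi => e; rewrite G'_order ?e ?eqxx.
have nu0 : nu j != mnm0 by apply: contraNneq Gj => e; rewrite G'_order ?e ?eqxx ?orbT.
have wa : wt (mu i +m mnm1 (zi i)) = (wt a).+1 by rewrite wtD wt_zi wmu addn1.
have wb : wt (nu j +m mnm1 (zi j)) = (wt b).+1 by rewrite wtD wt_zi wnu addn1.
rewrite -leading_coef.
- apply: eq_bigr => k _; case: ifP => // /andP[]; rewrite !lep1mP => ka kb.
  have -> : wt (mu i +m mnm1 (zi i) -m mnm1 (zi k)) = wt a.
    by have := wtB ka; rewrite wa wt_zi; lia.
  have -> : wt (nu j +m mnm1 (zi j) -m mnm1 (zi k)) = wt b.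
    by have := wtB kb; rewrite wb wt_zi; lia.
  by rewrite !eqxx.
- by rewrite mdegD mdeg1; move: mu0; rewrite -mdeg_eq0; lia.
- by rewrite mdegD mdeg1; move: nu0; rewrite -mdeg_eq0; lia.
by rewrite wa wb; lia.
Qed.

End Step.

Lemma G'_eq0 : G' = 0.
Proof.
apply: cfP => a b; rewrite cf0.
have [m] := ubnP (wt a + wt b); elim: m a b => // m IH a b.
rewrite ltnS leq_eqVlt => /orP[/eqP abm|]; last exact: IH.
exact: (@G'_step m).
Qed.

Lemma F_linear a k : (2 <= mdeg a)%N -> F k a = 0.
Proof. by move=> a2; apply: bidegree_a1_zero => // j; rewrite G'_eq0 cf0 mul0rn. Qed.

Lemma q_linear a : (2 <= mdeg a)%N -> q a = 0.
Proof.
move=> a2; have := bidegree_a1 wi a2; rewrite G'_eq0 cf0 mul0rn mulr0 eqxx mulr1.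
rewrite big1 => [|k _]; last by rewrite F_linear // mul0r mulr0.
rewrite mulr0 subr0 mulNr => /eqP; rewrite oppr_eq0 mulf_eq0 (negPf (two_i_neq0 R)) /=.
by move/eqP.
Qed.

Lemma A1_eq_A2 : A1 = A2.
Proof.
apply: cfP => a b; have [ab|] := boolP ((mdeg a < 2) || (mdeg b < 2))%N.
  by rewrite A1_order // A2_order.
rewrite negb_or -!leqNgt => /andP[a2 b2].
have G0 a' b' : (wt a' + wt b' < wt a + wt b - 2)%N -> cf G' a' b' = 0.
  by move=> _; rewrite G'_eq0 cf0.
have := leading_coef G0 a2 b2; have := mdeg_le_wt a; have := mdeg_le_wt b => wa wb.
rewrite subnK; last by lia.
move=> /(_ erefl); rewrite /mul_form big1.
  by move=> /esym/eqP; rewrite cfB subr_eq0 => /eqP.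
by move=> j _; rewrite G'_eq0 cf0 if_same mulr0.
Qed.

End Core.

(** * Equivalences are linear fractional *)

Section Normalization.
Variables (R : realType) (n l : nat).
Local Notation C := R[i].
Local Notation N := (n + 1)%N.
Local Notation zi := (@zi n).
Local Notation wi := (@wi n).
Local Notation sgn := (@levi_sign R n l).
Variables (k1 k2 : nat) (A1 A2 : fps C (N + N)) (H : 'rV[fps C N]_N).
Hypotheses (k_lt_n : (k1 + k2 < n)%N) (A1_H : Hclass k1 A1) (A2_H : Hclass k2 A2).
Hypothesis H0 : no_constant_term H.
Hypothesis Hw : exists i, H 0 wi (mnm1 i) != 0.
Hypothesis H_sends : sends H (fdefining l A1) (fdefining l A2).

(** H is the linear fractional map (F, c w) / q. The relations are cleared of
    denominators, so that they hold between series. *)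
Record linear_fractional (c : C) (q : fps C N) (F : 'I_n -> fps C N) : Prop := LinearFractional {
  lf_neq0 : c != 0;
  lf_real : c^* = c;
  lf_q0 : q mnm0 = 1;
  lf_z : forall j, q * H 0 (zi j) = F j;
  lf_w : q * H 0 wi = c *: fpsX C wi;
  lf_F0 : forall j, F j mnm0 = 0;
  lf_F_linear : forall a j, (2 <= mdeg a)%N -> F j a = 0;
  lf_q_linear : forall a, (2 <= mdeg a)%N -> q a = 0;
  lf_isometry : first_order_isometry l c q F;
  lf_A : A1 = c^-1 *: (holo q * fps_conj (holo q) * comp_bar A2 H) }.

(** Put p(Z) = G(Z, 0), c = p(0) and q = c / p. Multiplied by
    q(Z) conj(q(Z)) / c, the equation becomes the normalized one: the map q H has the
    components q f and c w, and the factor q qbar G / c = 1 + G' is 1 both at Z = 0 and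
    at Zbar = 0. *)
Lemma sends_linear_fractional : exists c q F, linear_fractional c q F.
Proof.
have A1r : fps_conj A1 = A1 by case: A1_H.
have A2r : fps_conj A2 = A2 by case: A2_H.
have A1o := Hclass_order A1_H; have A2o := Hclass_order A2_H.
have [G [GE HwE Gr]] := sends_normal_component H0 A1o A2o A1r A2r H_sends.
pose p := at_Zbar0 G; pose c := p mnm0.
have c_real : c^* = c.
  by rewrite /c /p -{2}Gr !at_Zbar0E cf_conj.
have c0 : c != 0.
  have [i0] := Hw; rewrite HwE fcoefMX -/p; have [->|iw] := eqVneq i0 wi.
    have -> : mnm1 wi -m mnm1 wi = mnm0 :> multinom N.
      by apply/mnmP => k; rewrite mnmBE mnm0E subnn.
    by apply: contra_neq => c0; rewrite -/c c0 mul0rn.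
  by rewrite mnm1E (negPf iw) mulr0n eqxx.
have [u pu] := fps_inverse c0; pose q := c *: u.
have pq : p * q = c *: 1 by rewrite /q -scalerAr pu.
have q0 : q mnm0 = 1.
  have /fpsP/(_ mnm0) := pq; rewrite fcoefZ fcoef1 eqxx mulr1 -[mnm0 in LHS]addm0.
  rewrite fcoefM_single -/c => [/(canRL (mulKf c0))->|b' c' b'0 e]; first by rewrite mulVf.
  by move/esym/eqP: e; rewrite addm0 mnmD_eq0 (negPf b'0).
pose F j := q * H 0 (zi j).
have F0 j : F j mnm0 = 0.
  apply/order_ge1P; rewrite -[1%N]/(0 + 1)%N; apply: order_geM => //.
  exact/order_ge1P.
have qHw : q * H 0 wi = c *: fpsX C wi.
  by rewrite HwE -/p mulrA [q * p]mulrC pq -scalerAl mul1r.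
pose hq := holo q; pose cq := fps_conj hq.
pose G' := c^-1 *: (hq * cq * G) - 1.
pose A2' := c^-1 *: (hq * cq * comp_bar A2 H).
have A2'o : bi_order_ge2 A2'.
  apply: bi_orderZ; rewrite -mulrA; apply: bi_order_holoM; apply: bi_order_conj_holoM.
  exact: bi_order_comp_bar.
have A2'r : rank_le k2 A2'.
  apply: rank_leZ; rewrite -mulrA; apply: rank_le_holoM; apply: rank_le_conj_holoM.
  exact/rank_le_comp_bar/(Hclass_rank A2_H).
have holo_qw : hq * holo (H 0 wi) = c *: fpsX C (lshift N wi).
  by rewrite -holoM qHw holoZ holoX !mxE.
have conj_qw : cq * fps_conj (holo (H 0 wi)) = c *: fpsX C (rshift N wi).
  by rewrite -fps_conjM holo_qw fps_conjZ c_real fps_conjXl.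
have atG : at_Zbar0 (c^-1 *: (hq * cq * G)) = 1.
  rewrite at_Zbar0Z !at_Zbar0M at_Zbar0_holo at_Zbar0_conj_holo q0 rmorph1 scale1r mulr1.
  by rewrite -/p mulrC pq scalerA mulVf // scale1r.
have atG_conj : at_Zbar0 (fps_conj (c^-1 *: (hq * cq * G))) = 1.
  rewrite fps_conjZ !fps_conjM fps_conjK fmorphV /= c_real [cq * hq]mulrC.
  rewrite at_Zbar0Z !at_Zbar0M Gr at_Zbar0_holo at_Zbar0_conj_holo q0 rmorph1 scale1r mulr1.
  by rewrite -/p mulrC pq scalerA mulVf // scale1r.
have G'o a b : (a == mnm0) || (b == mnm0) -> cf G' a b = 0.
  case/orP => /eqP ->; rewrite /G' cfB cf1 eqxx ?andbT.
    rewrite -[X in X - _]conjCK -cf_conj -at_Zbar0E atG_conj fcoef1.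
    by rewrite rmorph_nat subrr.
  by rewrite -at_Zbar0E atG fcoef1 subrr.
have normalized :
  (2 * 'i)^-1 *: (fpsX C (lshift N wi) * fps_conj (holo q) - holo q * fpsX C (rshift N wi))
  - c^-1 *: (\sum_j sgn j *: (holo (F j) * fps_conj (holo (F j)))) - A2'
  = (1 + G') * fdefining l A1.
  have -> : 1 + G' = c^-1 *: (hq * cq * G) by rewrite /G' addrC subrK.
  rewrite -scalerAl -[hq * cq * G * _]mulrA -GE comp_bar_fdefining // !mulrBr !scalerBr.
  rewrite /A2' -/hq -/cq; congr (_ - _ - _).
    have sw : c^-1 *: (hq * cq * holo (H 0 wi)) = fpsX C (lshift N wi) * cq.
      by rewrite [hq * cq]mulrC -mulrA holo_qw -scalerAr scalerA mulVf // scale1r mulrC.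
    have sw' : c^-1 *: (hq * cq * fps_conj (holo (H 0 wi))) = hq * fpsX C (rshift N wi).
      by rewrite -mulrA conj_qw -scalerAr scalerA mulVf // scale1r.
    by rewrite -sw -sw' -!scalerBr -scalerAr mulrBr scalerA [_ * c^-1]mulrC -scalerA.
  congr (_ *: _); rewrite mulr_sumr; apply: eq_bigr => j _.
  by rewrite -scalerAr /F !holoM fps_conjM -/hq -/cq; congr (_ *: _); ring.
exists c, q, F; split=> //.
- move=> a j a2.
  exact: (F_linear c0 A1o A2'o G'o normalized (Hclass_rank A1_H) A2'r k_lt_n j a2).
- by move=> a a2; exact: (q_linear c0 A1o A2'o G'o normalized (Hclass_rank A1_H) A2'r k_lt_n).
- exact: (bidegree11 c0 A1o A2'o G'o normalized).
exact: (A1_eq_A2 c0 A1o A2'o G'o normalized (Hclass_rank A1_H) A2'r k_lt_n).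
Qed.

End Normalization.

(** * Taylor series of linear fractional maps *)

Section Taylor.
Local Open Scope classical_set_scope.
Variables (R : realType) (N : nat).
Local Notation C := R[i].
Local Notation V := 'rV[C]_N.

Definition affine (c0 : C) (v : 'I_N -> C) (Z : V) : C := c0 + \sum_i v i * Z 0 i.

Lemma is_derive_affine c0 v (Z : V) i : is_derive Z (delta_mx 0 i) (affine c0 v) (v i).
Proof.
have lim : (fun h : C => h^-1 *: ((affine c0 v \o shift Z) (h *: delta_mx 0 i) - affine c0 v Z))
    @ 0^' --> (v i : C).
  apply: cvg_near_cst; near=> h.
  have h0 : h != 0 by near: h; exact: nbhs_dnbhs_neq.
  rewrite /affine /= opprD addrACA subrr add0r -sumrB.
  rewrite (bigD1 i) //= big1 ?addr0; last first.
    by move=> j ji; rewrite !mxE (negPf ji) andbF mulr0 add0r subrr.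
  by rewrite !mxE !eqxx mulr1 -mulrBr addrK [v i * h]mulrC scalerA mulVf // scale1r.
by apply: DeriveDef; [apply/cvg_ex; exists (v i) | exact: cvg_lim lim].
Unshelve. all: by end_near.
Qed.

Lemma differentiable_affine c0 v (Z : V) : differentiable (affine c0 v) Z.
Proof.
have -> : affine c0 v = cst c0 + \sum_i (fun Y : V => v i *: Y 0 i).
  by apply/funext => Y; rewrite /affine /= fct_sumE.
apply: differentiableD => //; apply: differentiable_sum => i.
by apply: differentiableZ; exact: differentiable_coord.
Qed.

Definition affine_fps (c0 : C) (v : 'I_N -> C) : fps C N := c0 *: 1 + \sum_i v i *: fpsX C i.

(** On P, the function phi a plays the part of the iterated partial derivative of
    exponent a of phi 0, whatever the order of the derivations. *)
Definition derivative_family (P : set V) (phi : multinom N -> V -> C) :=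
  forall a i Z, P Z -> is_derive Z (delta_mx 0 i) (phi a) (phi (a +m mnm1 i) Z).

Lemma taylor_family (P : set V) phi f a : (forall Z, P Z -> \near Z, P Z) -> P 0 ->
  derivative_family P phi -> (forall Z, P Z -> f Z = phi mnm0 Z) ->
  taylor f a = phi a 0 / (\prod_i (a i)`!)%:R.
Proof.
move=> Pnear P0 dphi fphi; rewrite /taylor /=; congr (_ / _).
pose D (i : 'I_N) (g : V -> C) (Z : V) : C := 'D_(delta_mx 0 i) g Z.
have iterP i q g b : (forall Z, P Z -> g Z = phi b Z) ->
    forall Z, P Z -> iter q (D i) g Z = phi (b +m mnm_muln (mnm1 i) q) Z.
  move=> gb; elim: q => [|q IH] Z PZ; first by rewrite /= mulm0n addm0 gb.
  rewrite iterS /D (@near_eq_derive _ _ _ _ (phi (b +m mnm_muln (mnm1 i) q))).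
    by rewrite mulmSr addmA; have [_ ->] := dphi (b +m mnm_muln (mnm1 i) q) i Z PZ.
  by near=> Y; apply: IH; near: Y; exact: Pnear.
rewrite [a in RHS]multinomUE_id -[X in phi X _]big_enum /multi_deriv.
elim: (enum 'I_N) 0 P0 => [|i s IH] Z PZ /=; first by rewrite big_nil fphi.
rewrite big_cons (@iterP i (a i) _ (\big[@mnm_add N/@mnm0 N]_(j <- s) mnm_muln (mnm1 j) (a j))) //.
by congr (phi _ _); rewrite addmC.
Unshelve. all: by end_near.
Qed.

(** The Leibniz rule for the product with an affine function, whose derivatives of
    order 2 vanish. *)
Definition mul_affine_family c0 v (phi : multinom N -> V -> C) a Z :=
  affine c0 v Z * phi a Z + \sum_i (a i)%:R * v i * phi (a -m mnm1 i) Z.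

Lemma derivative_family_mul_affine c0 v P phi : derivative_family P phi ->
  derivative_family P (mul_affine_family c0 v phi).
Proof.
move=> dphi a i Z PZ.
have -> : mul_affine_family c0 v phi a =
   (affine c0 v : V -> C) * phi a + \sum_j (fun Z => ((a j)%:R * v j) *: phi (a -m mnm1 j) Z).
  by apply/funext => Y; rewrite /mul_affine_family !fctE fct_sumE.
have da := dphi a i Z PZ; have dL := is_derive_affine c0 v Z i.
have ds j : is_derive Z (delta_mx 0 i) (fun Z => ((a j)%:R * v j) *: phi (a -m mnm1 j) Z)
    (((a j)%:R * v j) *: phi (a -m mnm1 j +m mnm1 i) Z).
  by apply: is_deriveZ; exact: dphi.
apply: (is_derive_eq (is_deriveD (is_deriveM dL da) (is_derive_sum ds))).
rewrite /mul_affine_family -addrA; congr (_ + _).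
rewrite [in RHS](eq_bigr (fun j => (a j)%:R * v j * phi (a +m mnm1 i -m mnm1 j) Z +
    (i == j)%:R * v j * phi (a +m mnm1 i -m mnm1 j) Z)); last first.
  by move=> j _; rewrite mnmDE mnm1E natrD !mulrDl.
rewrite big_split /= addrC; congr (_ + _).
  apply: eq_bigr => j _; have [->|aj] := eqVneq (a j) 0%N; first by rewrite !mul0r scale0r.
  rewrite [LHS]/(_ * _); congr (_ * phi _ _); apply/mnmP => k; rewrite !(mnmDE, mnmBE) mnm1E.
  by case: eqP => [<-|]; lia.
rewrite (bigD1 i) //= eqxx mul1r big1 ?addr0; last first.
  by move=> j /negPf ji; rewrite eq_sym ji !mul0r.
by rewrite addmK mulrC.
Qed.

Lemma affine_fpsM c0 v (t : fps C N) :
  affine_fps c0 v * t = c0 *: t + \sum_i v i *: (t * fpsX C i).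
Proof.
rewrite /affine_fps mulrDl mulr_suml; congr (_ + _); first by rewrite -scalerAl mul1r.
by apply: eq_bigr => i _; rewrite -scalerAl [t * _]mulrC.
Qed.

Lemma prod_fact_sub (a : multinom N) i : a i != 0%N ->
  (\prod_j (a j)`! = a i * \prod_j ((a -m mnm1 i) j)`!)%N.
Proof.
move=> ai; rewrite (bigD1 i) //= [in RHS](bigD1 i) //= mulnA; congr (_ * _)%N.
  by rewrite mnmBE mnm1E eqxx subn1 -{1}(prednK (n := a i)) ?lt0n // factS prednK ?lt0n.
by apply: eq_bigr => j ji; rewrite mnmBE mnm1E eq_sym (negPf ji) subn0.
Qed.

(** Divided by a!, the Leibniz rule is the formula for the coefficients of the
    product with the series c0 + v_1 X_1 + ... + v_N X_N. *)
Lemma taylor_mul_affine (P : set V) phi f c0 v : (forall Z, P Z -> \near Z, P Z) -> P 0 ->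
  derivative_family P phi -> (forall Z, P Z -> f Z = phi mnm0 Z) ->
  taylor (fun Z => affine c0 v Z * f Z) = affine_fps c0 v * taylor f.
Proof.
move=> Pnear P0 dphi fphi; apply/fpsP => a.
rewrite (taylor_family a Pnear P0 (derivative_family_mul_affine c0 v dphi)); last first.
  move=> Z PZ; rewrite /mul_affine_family fphi // big1 ?addr0 // => i _.
  by rewrite mnm0E !mul0r.
rewrite affine_fpsM fcoefD fcoefZ fcoef_sum.
rewrite /mul_affine_family mulrDl; congr (_ + _).
  rewrite (taylor_family a Pnear P0 dphi fphi) /affine big1 ?addr0 ?mulrA // => i _.
  by rewrite mxE mulr0.
rewrite mulr_suml; apply: eq_bigr => i _.
rewrite fcoefZ fcoefMX.
have [->|ai] := eqVneq (a i) 0%N; first by rewrite !mul0r mulr0n mulr0.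
rewrite mulr1n (taylor_family _ Pnear P0 dphi fphi) (prod_fact_sub ai) natrM invfM.
have ai0 : (a i)%:R != 0 :> C by rewrite pnatr_eq0.
have X0 : (\prod_j ((a -m mnm1 i) j)`!)%:R != 0 :> C by exact: prod_fact_neq0.
by field; rewrite ai0 X0.
Qed.

Lemma taylor_one_on (P : set V) f : (forall Z, P Z -> \near Z, P Z) -> P 0 ->
  (forall Z, P Z -> f Z = 1) -> taylor f = 1.
Proof.
move=> Pnear P0 f1; apply/fpsP => a.
rewrite (@taylor_family P (fun a Z => (a == mnm0)%:R) f a) //; last first.
- by move=> Z /f1 ->; rewrite eqxx.
- move=> b i Z _; have -> : (b +m mnm1 i == mnm0) = false.
    by rewrite mnmD_eq0 mnm1_eq0 andbF.
  exact: is_derive_cst.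
rewrite fcoef1; have [->|_] := eqVneq a mnm0; last by rewrite mul0r.
by rewrite big1 ?divr1 // => i _; rewrite mnm0E.
Qed.

Lemma taylor_affine c0 v : taylor (affine c0 v) = affine_fps c0 v.
Proof.
have -> : affine c0 v = (fun Z => affine c0 v Z * (cst 1 : V -> C) Z).
  by apply/funext => Z; rewrite mulr1.
rewrite (@taylor_mul_affine setT (fun a Z => (a == mnm0)%:R)) //.
- rewrite (@taylor_one_on setT) ?mulr1 // => Z _; exact: filterT.
- by move=> Z _; exact: filterT.
- move=> b i Z _; have -> : (b +m mnm1 i == mnm0) = false.
    by rewrite mnmD_eq0 mnm1_eq0 andbF.
  exact: is_derive_cst.
by move=> Z _; rewrite eqxx.
Qed.

Lemma affine_neq0_near c0 v (Z : V) : affine c0 v Z != 0 -> \near Z, affine c0 v Z != 0.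
Proof.
move=> Z0; have := differentiable_continuous (differentiable_affine c0 v Z).
by move=> /cvgr_neq0; apply.
Qed.

(** The iterated partial derivatives of the inverse of an affine function. *)
Definition inv_affine_family c0 v (a : multinom N) (Z : V) : C :=
  ((-1) ^+ mdeg a * (mdeg a)`!%:R * \prod_i v i ^+ a i) * (affine c0 v Z)^-1 ^+ (mdeg a).+1.

Lemma derivative_family_inv_affine c0 v :
  derivative_family [set Z | affine c0 v Z != 0] (inv_affine_family c0 v).
Proof.
move=> a i Z /= Z0; have dL := is_derive_affine c0 v Z i.
have dI : is_derive Z (delta_mx 0 i) (fun Y => (affine c0 v Y)^-1)
    (- (affine c0 v Z) ^- 2 *: v i).
  by apply: DeriveDef; [exact: derivableV | rewrite deriveV // derive_val].
have dX := is_deriveX (mdeg a).+1 dI.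
have -> : inv_affine_family c0 v a = ((-1) ^+ mdeg a * (mdeg a)`!%:R * \prod_i v i ^+ a i) \*:
    ((fun Y => (affine c0 v Y)^-1) ^+ (mdeg a).+1).
  by apply/funext => Y; rewrite /inv_affine_family /= fctE.
apply: (is_derive_eq (is_deriveZ _ dX)).
rewrite /inv_affine_family mdegD mdeg1 addn1 factS natrM.
have -> : \prod_j v j ^+ (a +m mnm1 i) j = v i * \prod_j v j ^+ a j.
  rewrite (bigD1 i) //= [in RHS](bigD1 i) //= mnmDE mnm1E eqxx addn1 exprS mulrA.
  congr (_ * _); apply: eq_bigr => j ji; rewrite mnmDE mnm1E eq_sym (negPf ji) addn0 //.
rewrite -[LHS]/((-1) ^+ mdeg a * (mdeg a)`!%:R * (\prod_j v j ^+ a j) *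
  ((mdeg a).+1%:R * (affine c0 v Z)^-1 ^+ mdeg a * (- (affine c0 v Z) ^- 2 * v i))).
set X := \prod_j _; rewrite !exprVn !exprS expr0.
have Zm : affine c0 v Z ^+ mdeg a != 0 by rewrite expf_neq0.
by field; rewrite Z0 Zm.
Qed.

Lemma taylor_inv_affine c0 v : c0 != 0 ->
  affine_fps c0 v * taylor (fun Z : V => (affine c0 v Z)^-1) = 1.
Proof.
move=> c00; set P := [set Z | affine c0 v Z != 0].
have Pnear Z : P Z -> \near Z, P Z by exact: affine_neq0_near.
have P0 : P 0 by rewrite /P /= /affine big1 ?addr0 // => i _; rewrite mxE mulr0.
rewrite -(taylor_mul_affine _ _ Pnear P0 (derivative_family_inv_affine (c0 := c0) (v := v))).
  by apply: (taylor_one_on Pnear P0) => Z PZ; rewrite mulfV.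
move=> Z _; rewrite /inv_affine_family mdeg0 fact0 expr0 expr1 big1 ?mul1r ?mulr1 // => i _.
by rewrite mnm0E.
Qed.

Lemma taylor_affine_frac c0 v d w : c0 != 0 ->
  affine_fps c0 v * taylor (fun Z : V => affine d w Z * (affine c0 v Z)^-1) = affine_fps d w.
Proof.
move=> c00; set P := [set Z | affine c0 v Z != 0].
have Pnear Z : P Z -> \near Z, P Z by exact: affine_neq0_near.
have P0 : P 0 by rewrite /P /= /affine big1 ?addr0 // => i _; rewrite mxE mulr0.
rewrite (taylor_mul_affine _ _ Pnear P0 (derivative_family_inv_affine (c0 := c0) (v := v))).
  by rewrite mulrCA taylor_inv_affine // mulr1.
move=> Z _; rewrite /inv_affine_family mdeg0 fact0 expr0 expr1 big1 ?mul1r ?mulr1 // => i _.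
by rewrite mnm0E.
Qed.

End Taylor.

(** * Germs of local biholomorphisms *)

Section Germ.
Local Open Scope classical_set_scope.
Variables (R : realType) (N : nat).
Local Notation C := R[i].
Local Notation V := 'rV[C]_N.

Lemma multi_deriv_mnm0 (T : Type) (D : 'I_N -> T -> T) x : multi_deriv D (@mnm0 N) x = x.
Proof. by rewrite /multi_deriv; elim: (enum _) => //= i s ->; rewrite mnm0E. Qed.

Lemma multi_deriv_mnm1 (T : Type) (D : 'I_N -> T -> T) i x :
  multi_deriv D (mnm1 i) x = D i x.
Proof.
rewrite /multi_deriv; set f := fun j => _.
have fE j y : f j y = if j == i then D j y else y.
  by rewrite /f mnm1E eq_sym; case: eqP.
have notin s : i \notin s -> foldr f x s = x.
  elim: s => //= j s IH; rewrite inE negb_or => /andP[ij /IH ->].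
  by rewrite fE eq_sym (negPf ij).
have : i \in enum 'I_N by rewrite mem_enum.
elim: (enum _) (enum_uniq 'I_N) => //= j s IH /andP[js us].
rewrite inE fE; have [ji|ij] := eqVneq j i; last by move=> /= /(IH us).
by move=> _; rewrite ji notin -?ji.
Qed.

Lemma taylor_mnm0 (f : V -> C) : taylor f mnm0 = f 0.
Proof.
rewrite /taylor /= multi_deriv_mnm0 big1 ?divr1 // => i _; by rewrite mnm0E.
Qed.

Lemma taylor_mnm1 (f : V -> C) i : taylor f (mnm1 i) = 'D_(delta_mx 0 i) f 0.
Proof.
rewrite /taylor /= multi_deriv_mnm1 big1 ?divr1 // => j _; rewrite mnm1E.
by case: eqP.
Qed.

Lemma diff_coord (Y v : V) j : 'd (fun Z : V => Z 0 j : C) Y v = v 0 j.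
Proof.
rewrite -deriveE; last exact: differentiable_coord.
apply: cvg_lim => //; apply: cvg_near_cst; near=> h.
have h0 : h != 0 by near: h; exact: nbhs_dnbhs_neq.
by rewrite /= !mxE addrK scalerA mulVf // scale1r.
Unshelve. all: by end_near.
Qed.

Lemma jacobian0_taylor_map (T : V -> V) : differentiable T 0 ->
  jacobian0 (taylor_map T) = lin1_mx ('d T 0).
Proof.
move=> dT; apply/matrixP => i j; rewrite !mxE taylor_mnm1.
have dTj : differentiable ((fun Z : V => Z 0 j : C) \o T) 0.
  exact: (differentiable_comp dT (differentiable_coord _ _ _)).
have dE : 'd ((fun Z : V => Z 0 j : C) \o T) 0 = 'd (fun Z : V => Z 0 j : C) (T 0) \o 'd T 0
    :> (V -> C) := diff_comp dT (differentiable_coord _ _ _).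
transitivity ('D_(delta_mx 0 i) ((fun Z : V => Z 0 j : C) \o T) 0); first by [].
by rewrite (deriveE _ dTj) dE [LHS]/= diff_coord.
Qed.

(** The chain rule at 0 for S o T = id. *)
Lemma local_biholomorphism_jacobian (T : V -> V) : local_biholomorphism T ->
  jacobian0 (taylor_map T) \in unitmx.
Proof.
move=> [T0 hT [S [S0 hS ST]]].
have dT := nbhs_singleton hT; have dS := nbhs_singleton hS.
rewrite jacobian0_taylor_map //.
suff JJ : lin1_mx ('d T 0) *m lin1_mx ('d S 0) = 1%:M by exact: (mulmx1_unit JJ).1.
apply/row_matrixP => i; rewrite !rowE mulmxA !mul_rV_lin1 mulmx1.
have dS' : differentiable S (T 0) by rewrite T0.
have dE := diff_comp dT dS'; rewrite T0 in dE.
transitivity ('d (S \o T) 0 (delta_mx 0 i)).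
  exact: esym (congr1 (fun f : V -> V => f (delta_mx 0 i)) dE).
rewrite -(deriveE _ (differentiable_comp dT dS')).
rewrite (@near_eq_derive _ _ _ _ id) ?derive_id //.
by near=> Z; have [] : S (T Z) = Z /\ T (S Z) = Z by near: Z.
Unshelve. all: by end_near.
Qed.

Lemma taylor_map_nct (T : V -> V) : T 0 = 0 -> no_constant_term (taylor_map T).
Proof. by move=> T0 i; rewrite mxE taylor_mnm0 T0 mxE. Qed.

Definition linfrac (M : 'M[C]_N) (v : 'cV[C]_N) (Z : V) : V :=
  (1 + (Z *m v) 0 0)^-1 *: (Z *m M).

Lemma linfrac_denE (v : 'cV[C]_N) (Z : V) :
  1 + (Z *m v) 0 0 = affine 1 (fun i => v i 0) Z.
Proof. by rewrite mxE; congr (_ + _); apply: eq_bigr => i _; rewrite mulrC. Qed.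

Lemma affine1_at0 v : affine 1 v (0 : V) != 0.
Proof. by rewrite /affine big1 ?addr0 ?oner_eq0 // => i _; rewrite mxE mulr0. Qed.

Lemma linfrac_den_near (v : 'cV[C]_N) : \forall Z \near (0 : V), 1 + (Z *m v) 0 0 != 0.
Proof.
near=> Z; rewrite linfrac_denE; near: Z; apply: affine_neq0_near.
exact: affine1_at0.
Unshelve. all: by end_near.
Qed.

Lemma differentiable_linfrac M v (Z : V) : 1 + (Z *m v) 0 0 != 0 ->
  differentiable (linfrac M v) Z.
Proof.
move=> Z0; have -> : linfrac M v = \sum_j (fun Y : V =>
    ((affine 1 (fun i => v i 0) Y)^-1 * affine 0 (fun i => M i j) Y) *: (delta_mx 0 j : V)).
  apply/funext => Y; rewrite fct_sumE; apply/rowP => k.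
  rewrite summxE (bigD1 k) //= big1 ?addr0; last first.
    by move=> j jk; rewrite !mxE eq_sym (negPf jk) andbF mulr0.
  rewrite /linfrac linfrac_denE !mxE !eqxx mulr1 /affine add0r; congr (_ * _).
  by apply: eq_bigr => i _; rewrite mulrC.
apply: differentiable_sum => j; apply: differentiableZl.
apply: differentiableM; last exact: differentiable_affine.
by apply: differentiableV; [exact: differentiable_affine | rewrite -linfrac_denE].
Qed.

(** The denominators of the two maps at corresponding points are inverse to each
    other. *)
Lemma linfracK M M' v (Z : V) : M *m M' = 1%:M -> 1 + (Z *m v) 0 0 != 0 ->
  linfrac M' (- (M' *m v)) (linfrac M v Z) = Z.
Proof.
move=> MM'; set d := 1 + _ => d0.
have den : 1 + (linfrac M v Z *m - (M' *m v)) 0 0 = d^-1.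
  rewrite /linfrac -/d mulmxN mulmxA -!scalemxAl -[Z *m M *m M']mulmxA MM' mulmx1.
  apply: (mulfI d0); rewrite mulfV // 2!mxE mulrDr mulr1 mulrN mulrA mulfV // mul1r.
  by rewrite /d addrK.
rewrite /linfrac in den *; rewrite den invrK -/d -!scalemxAl -[Z *m M *m M']mulmxA MM' mulmx1.
by rewrite scalerA mulfV // scale1r.
Qed.

Lemma linfrac0 M v : linfrac M v 0 = 0.
Proof. by rewrite /linfrac !mul0mx scaler0. Qed.

Lemma local_biholomorphism_linfrac M v : M \in unitmx -> local_biholomorphism (linfrac M v).
Proof.
move=> Mu; pose M' := invmx M; pose v' := - (M' *m v).
have hol M1 v1 : holomorphic_at0 (linfrac M1 v1).
  near=> Z; apply: differentiable_linfrac; near: Z; exact: linfrac_den_near.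
split; [exact: linfrac0 | exact: hol | exists (linfrac M' v')].
split; [exact: linfrac0 | exact: hol | near=> Z; split].
  by apply: linfracK; rewrite ?mulmxV //; near: Z; exact: linfrac_den_near.
have -> : v = - (M *m v') by rewrite /v' mulmxN opprK mulmxA mulmxV ?mul1mx.
by apply: linfracK; rewrite ?mulVmx //; near: Z; exact: linfrac_den_near.
Unshelve. all: by end_near.
Qed.

End Germ.

(** * The automorphisms of the hyperquadric *)

Section Automorphism.
Local Open Scope classical_set_scope.
Variables (R : realType) (n l : nat).
Local Notation C := R[i].
Local Notation N := (n + 1)%N.
Local Notation zi := (@zi n).
Local Notation wi := (@wi n).
Local Notation sgn := (@levi_sign R n l).
Local Notation conjv := (map_mx Num.conj).

Lemma conj_lform (x y : 'rV[C]_n) : (lform l x (conjv y))^* = lform l y (conjv x).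
Proof.
rewrite !lformCE rmorph_sum; apply: eq_bigr => j _.
by rewrite !rmorphM /= !mxE conj_levi_sign conjCK [y 0 j * _]mulrC.
Qed.

Lemma lform_add_scale (x y x' y' : 'rV[C]_n) (s t : C) :
  lform l (x + s *: y) (x' + t *: y') =
  lform l x x' + t * lform l x y' + s * lform l y x' + s * t * lform l y y'.
Proof.
rewrite !lformCE !mulr_sumr -!big_split /=; apply: eq_bigr => j _; rewrite !mxE; ring.
Qed.

Lemma lformZ (x y : 'rV[C]_n) (s t : C) : lform l (s *: x) (t *: y) = s * t * lform l x y.
Proof. rewrite !lformCE mulr_sumr; apply: eq_bigr => j _; rewrite !mxE; ring. Qed.

Variables (lambda r : R) (a : 'rV[C]_n) (sigma : C) (U : 'M[C]_n).
Local Notation lam := (lambda%:C)%C.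
Local Notation den := (aut_den l r a).
Local Notation T := (aut_map l lambda r a sigma U).

Definition den_z (j : 'I_n) : C := - (2 * 'i * (sgn j * (a 0 j)^*)).
Definition den_w : C := - ((r%:C)%C + 'i * lform l a (conjv a)).
Definition den_col : 'cV[C]_N := col_mx (\col_j den_z j) (den_w%:M).
Definition aut_mx : 'M[C]_N :=
  block_mx (lam *: U) 0 (lam *: (a *m U)) ((sigma * lam ^+ 2)%:M).

Lemma aut_denE (Z : 'rV[C]_N) : den Z = 1 + (Z *m den_col) 0 0.
Proof.
rewrite -[in RHS](hsubmxK Z) mul_row_col !mxE /aut_den -addrA; congr (_ + _).
rewrite lformCE big_ord1 !mxE; congr (_ + _).
  rewrite mulr_sumr -sumrN; apply: eq_bigr => j _; rewrite !mxE /den_z; ring.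
rewrite /wcoord mxE /den_w mulr1n; ring.
Qed.

Lemma aut_mapE : T = linfrac aut_mx den_col.
Proof.
apply/funext => Z; rewrite /aut_map /linfrac aut_denE; congr (_ *: _).
rewrite -[Z in RHS]hsubmxK mul_row_block; congr row_mx.
  rewrite mulmxDl scalerDr -scalemxAr -/(zcoord Z); congr (_ + _).
  rewrite -scalemxAl (mx11_scalar (rsubmx Z)) -/(wcoord Z) mul_scalar_mx.
  by rewrite !scalerA mulrC.
by rewrite mulmx0 add0r (mx11_scalar (rsubmx Z)) -/(wcoord Z) -scalar_mxM mulrC.
Qed.

Hypotheses (lambda_gt0 : 0 < lambda) (sigmaE : sigma = 1 \/ sigma = -1).
Hypothesis U_unit : U \in unitmx.
Hypothesis U_isom : forall z : 'rV[C]_n,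
  lform l (z *m U) (conjv z *m conjv U) = sigma * lform l z (conjv z).

Lemma lam_neq0 : lam != 0.
Proof. by rewrite (inj_eq (@complexI R) _ 0) gt_eqF. Qed.

Lemma sigma_neq0 : sigma != 0.
Proof. by case: sigmaE => ->; rewrite ?oppr_eq0 oner_eq0. Qed.

Lemma conj_sigma : sigma^* = sigma.
Proof. by case: sigmaE => ->; rewrite ?rmorphN rmorph1. Qed.

Lemma conj_real (x : R) : ((x%:C)%C : C)^* = (x%:C)%C.
Proof. by apply/CrealP; apply/complex_realP; exists x. Qed.

Lemma aut_mx_unit : aut_mx \in unitmx.
Proof.
rewrite unitmxE det_lblock unitrM -unitmxE unitmxZ ?unitfE ?lam_neq0 // U_unit /=.
by rewrite det_scalar1 mulf_neq0 ?sigma_neq0 // expf_neq0 ?lam_neq0.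
Qed.

(** If T(z, w) = (z', w') has the denominator d, then
    |d|^2 (Im w' - <z', zbar'>) = sigma lambda^2 (Im w - <z, zbar>). *)
Lemma aut_map_hyperquadric (Z : 'rV[C]_N) : den Z != 0 ->
  hyperquadric l (T Z) <-> hyperquadric l Z.
Proof.
move=> d0; set d := den Z in d0; set z := zcoord Z; set w := wcoord Z.
have wT : wcoord (T Z) = d^-1 * (sigma * lam ^+ 2 * w).
  by rewrite /wcoord /aut_map scale_row_mx row_mxKr !mxE mulr1n.
have zT : zcoord (T Z) = (d^-1 * lam) *: ((z + w *: a) *m U).
  by rewrite /zcoord /aut_map scale_row_mx row_mxKl scalerA.
have dE : d = 1 - 2 * 'i * lform l z (conjv a) - ((r%:C)%C + 'i * lform l a (conjv a)) * w by [].
have dcE : d^* = 1 + 2 * 'i * lform l a (conjv z)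
    - ((r%:C)%C - 'i * lform l a (conjv a)) * w^*.
  have c1 : (2 * 'i * lform l z (conjv a))^* = - (2 * 'i * lform l a (conjv z)).
    by rewrite rmorphM rmorphM /= rmorph_nat conjCi conj_lform mulrN mulNr.
  have c2 : (((r%:C)%C + 'i * lform l a (conjv a)) * w)^* =
      ((r%:C)%C - 'i * lform l a (conjv a)) * w^*.
    by rewrite rmorphM rmorphD rmorphM /= conj_real conjCi conj_lform mulNr.
  by rewrite dE rmorphB rmorphB /= c1 c2 rmorph1 opprK.
have dc0 : d^* != 0 by rewrite conjC_eq0.
have zTE : lform l (zcoord (T Z)) (conjv (zcoord (T Z))) =
    d^-1 * d^*^-1 * lam ^+ 2 * (sigma * (lform l z (conjv z) + w^* * lform l z (conjv a)
      + w * lform l a (conjv z) + w * w^* * lform l a (conjv a))).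
  rewrite zT map_mxZ map_mxM lformZ U_isom map_mxD map_mxZ lform_add_scale.
  rewrite rmorphM fmorphV /= conj_real; ring.
have wTE : (wcoord (T Z))^* = d^*^-1 * (sigma * lam ^+ 2 * w^*).
  have lam2 : (lam ^+ 2)^* = lam ^+ 2 by rewrite rmorphXn /= conj_real.
  by rewrite wT rmorphM /= fmorphV /= rmorphM /= rmorphM /= lam2 conj_sigma.
have key : 'Im (wcoord (T Z)) - lform l (zcoord (T Z)) (conjv (zcoord (T Z))) =
   (sigma * lam ^+ 2 * d^-1 * d^*^-1) * ('Im w - lform l z (conjv z)).
  rewrite zTE !ImE wTE wT.
  have i2 : 'i * 'i = -1 :> C by rewrite -expr2 sqrCi.
  have h : 'i * (d * w^* - d^* * w) / 2 = 'i * (w^* - w) / 2 + (w^* * lform l z (conjv a)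
      + w * lform l a (conjv z) + w * w^* * lform l a (conjv a)).
    transitivity ('i * (w^* - w) / 2 - ('i * 'i) * (w^* * lform l z (conjv a)
      + w * lform l a (conjv z) + w * w^* * lform l a (conjv a))).
      by rewrite dcE dE; field.
    by rewrite i2 mulN1r opprK.
  transitivity ((sigma * lam ^+ 2 * d^-1 * d^*^-1) * ('i * (d * w^* - d^* * w) / 2
     - (lform l z (conjv z) + (w^* * lform l z (conjv a)
      + w * lform l a (conjv z) + w * w^* * lform l a (conjv a))))).
    by field; rewrite dc0 d0.
  by rewrite h; ring.
rewrite /hyperquadric /= -/w -/z; split=> [/eqP|/eqP]; rewrite -subr_eq0.
  have k0 : sigma * lam ^+ 2 * d^-1 * d^*^-1 != 0.
    by rewrite !mulf_neq0 ?invr_eq0 ?sigma_neq0 ?lam_neq0.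
  by rewrite key mulf_eq0 (negPf k0) /= subr_eq0 => /eqP.
by move=> /eqP e; apply/eqP; rewrite -subr_eq0 key e mulr0.
Qed.

Lemma aut_hyperquadric_aut_map : aut_hyperquadric l T.
Proof.
split; first by rewrite aut_mapE; apply: local_biholomorphism_linfrac aut_mx_unit.
near=> Z; apply: aut_map_hyperquadric; rewrite aut_denE; near: Z.
exact: linfrac_den_near.
Unshelve. all: by end_near.
Qed.

End Automorphism.

(** * The parameters of an equivalence *)

Section EquivalenceData.
Variables (R : realType) (n l : nat).
Local Notation C := R[i].
Local Notation N := (n + 1)%N.
Local Notation zi := (@zi n).
Local Notation wi := (@wi n).
Local Notation sgn := (@levi_sign R n l).
Local Notation conjv := (map_mx Num.conj).

Lemma fps_affineP (f : fps C N) : (forall a, (2 <= mdeg a)%N -> f a = 0) ->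
  f = affine_fps (f mnm0) (fun i => f (mnm1 i)).
Proof.
move=> f2; apply/fpsP => a; rewrite [RHS]fcoefD fcoefZ fcoef1 fcoef_sum.
have [a2|] := leqP 2 (mdeg a).
  have -> : (a == mnm0) = false by apply/negbTE; rewrite -mdeg_eq0; lia.
  rewrite (f2 _ a2).
  rewrite mulr0 add0r big1 // => i _; rewrite fcoefZ /=.
  by case: eqP => [e|_]; [move: a2; rewrite e mdeg1 | rewrite mulr0].
rewrite ltnS leq_eqVlt ltnS leqn0 => /orP[/mdeg1P[j /eqP ->]|].
  rewrite mnm1_eq0 mulr0 add0r (bigD1 j) //= eqxx mulr1 big1 ?addr0 // => i ij.
  by rewrite eq_mnm1 eq_sym (negPf ij) mulr0.
rewrite mdeg_eq0 => /eqP ->; rewrite eqxx mulr1 big1 ?addr0 // => i _.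
by rewrite fcoefZ /= eq_sym mnm1_eq0 mulr0.
Qed.

Lemma split_N (P : 'I_N -> Prop) : (forall j, P (zi j)) -> P wi -> forall i, P i.
Proof.
move=> Pz Pw i; rewrite -(splitK i); case: (fintype.split i) => j /=; first exact: Pz.
by rewrite (_ : rshift n j = wi) //; congr (rshift n _); rewrite (ord1 j).
Qed.

Lemma sign_square (c : C) : c != 0 -> c^* = c ->
  exists (lambda : R) (sigma : C),
    [/\ 0 < lambda, sigma = 1 \/ sigma = -1 & c = sigma * (lambda%:C)%C ^+ 2].
Proof.
move=> c0 /CrealP/complex_realP[k ck].
have k0 : k != 0 by apply: contra_neq c0 => k0; rewrite ck k0.
exists (Num.sqrt `|k|); exists (Num.sg k)%:C%C.
have sq : (((Num.sqrt `|k|)%:C)%C : C) ^+ 2 = ((`|k|)%:C)%C.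
  by rewrite -rmorphXn /= sqr_sqrtr.
split; first by rewrite sqrtr_gt0 normr_gt0.
  have [/ltr0_sg ->|/gtr0_sg ->|/eqP] := ltgtP k 0.
  - right; by rewrite rmorphN rmorph1.
  - by left.
  by rewrite (negPf k0).
by rewrite sq -rmorphM /= -numEsg.
Qed.

Variables (A1 A2 : fps C (N + N)) (H : 'rV[fps C N]_N).
Variables (c : C) (q : fps C N) (F : 'I_n -> fps C N).
Hypothesis lf : linear_fractional l A1 A2 H c q F.

(** The linear part of F is (z, w) -> z L + w b. It must equal
    lambda (z + w a) U, and the last component of T requires c = sigma lambda^2; thus
    U = L / lambda and a = b L^-1. The relations of bidegree (1, 1) say that U is an
    isometry up to sigma and give the coefficients of q, in which r remains free. *)
Lemma lf_aut_map : exists (lambda r : R) (a : 'rV[C]_n) (sigma : C) (U : 'M[C]_n),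
  let T := aut_map l lambda r a sigma U in
  let Q := holo (taylor (aut_den l r a)) in
  [/\ 0 < lambda, sigma = 1 \/ sigma = -1, U \in unitmx &
      forall z : 'rV[C]_n,
        lform l (z *m U) (conjv z *m conjv U) = sigma * lform l z (conjv z)] /\
  [/\ aut_hyperquadric l T, H = taylor_map T &
      A1 = (sigma * (lambda%:C)%C ^- 2) *: (Q * fps_conj Q * comp_bar A2 (taylor_map T))].
Proof.
case: lf => c0 c_real q0 qz qw F0 F2 q2 isom A1E.
have [lambda [sigma [lam_gt0 sigmaE cE]]] := sign_square c0 c_real.
pose lam : C := (lambda%:C)%C; rewrite -/lam in cE.
have lam0 : lam != 0 by exact: lam_neq0.
have sig0 := sigma_neq0 sigmaE.
pose L := jac_z F; pose b : 'rV[C]_n := \row_k F k (mnm1 wi).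
have /andP[L_unit _] := jac_z_unit c0 isom; rewrite -/L in L_unit.
have LL x y : lform l (x *m L) (conjv (y *m L)) = c * lform l x (conjv y).
  exact: lform_jac_z isom x y.
pose U := lam^-1 *: L; pose a := b *m invmx L.
have aL : a *m L = b by rewrite /a mulmxKV.
have lamU : lam *: U = L by rewrite /U scalerA mulfV // scale1r.
have U_unit : U \in unitmx by rewrite unitmxZ ?unitfE ?invr_eq0.
have U_isom (z : 'rV[C]_n) :
    lform l (z *m U) (conjv z *m conjv U) = sigma * lform l z (conjv z).
  rewrite -map_mxM /U -scalemxAr map_mxZ lformZ LL fmorphV /= conj_real mulrA; congr (_ * _).
  by rewrite cE; field.
pose r : R := - complex.Re (q (mnm1 wi)).
have i0 : ('i : C) != 0 by exact: neq0Ci.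
have q_z j : q (mnm1 (zi j)) = den_z l a j.
  have := isom (zi j) wi; rewrite zi_neq_wi eqxx mul0r mulr1 sub0r.
  have -> : \sum_k sgn k * ((zi j == zi k) && (wi == zi k))%:R = 0.
    by apply: big1 => k _; rewrite [wi == _]eq_sym zi_neq_wi andbF mulr0.
  rewrite oppr0.
  have -> : \sum_k sgn k * (F k (mnm1 (zi j)) * (F k (mnm1 wi))^*) = c * (sgn j * (a 0 j)^*).
    have := LL (delta_mx 0 j) a; rewrite aL !lformCE => e.
    transitivity (\sum_k sgn k * (((delta_mx 0 j : 'rV[C]_n) *m L) 0 k * (conjv b) 0 k)).
      by apply: eq_bigr => k _; rewrite -rowE !mxE.
    rewrite e (bigD1 j) //= big1 ?addr0; last first.
      by move=> k kj; rewrite !mxE (negPf kj) andbF mul0r mulr0.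
    by rewrite !mxE !eqxx mul1r.
  rewrite mulKf // => /eqP; rewrite subr_eq0 => /eqP e.
  rewrite /den_z -e; field; exact: i0.
have q_w : q (mnm1 wi) = den_w l r a.
  have := isom wi wi; rewrite eqxx mul1r mulr1.
  have -> : \sum_k sgn k * ((wi == zi k) && (wi == zi k))%:R = 0.
    by apply: big1 => k _; rewrite eq_sym zi_neq_wi mulr0.
  have -> : \sum_k sgn k * (F k (mnm1 wi) * (F k (mnm1 wi))^*) = c * lform l a (conjv a).
    by rewrite -LL aL lformCE; apply: eq_bigr => k _; rewrite !mxE.
  rewrite oppr0 mulKf // => /eqP; rewrite subr_eq0 => /eqP e.
  rewrite /den_w -e /r rmorphN /= complexRe ReE; field; exact: i0.
have q_col i : q (mnm1 i) = den_col l r a i 0.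
  elim/split_N: i => [j|]; first by rewrite q_z /den_col col_mxEu mxE.
  by rewrite q_w /den_col col_mxEd mxE mulr1n.
have qE : q = affine_fps 1 (fun i => den_col l r a i 0).
  rewrite [q](fps_affineP q2) q0; congr (affine_fps 1 _); exact/funext.
have qT : taylor (aut_den l r a) = q.
  rewrite qE -taylor_affine; congr taylor; apply/funext => Z.
  by rewrite aut_denE linfrac_denE.
have HT : H = taylor_map (aut_map l lambda r a sigma U).
  have [u qu] : exists u, q * u = 1 by apply: fps_inverse; rewrite q0 oner_eq0.
  suff e k : q * H 0 k = q * taylor_map (aut_map l lambda r a sigma U) 0 k.
    apply/rowP => k; rewrite -[LHS]mulr1 -[RHS]mulr1 -qu.
    by rewrite !mulrA ![_ * q]mulrC e.
  have -> : taylor_map (aut_map l lambda r a sigma U) 0 k =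
      taylor (fun Z => affine 0 (fun i => aut_mx lambda a sigma U i k) Z
                       * (affine 1 (fun i => den_col l r a i 0) Z)^-1).
    rewrite mxE; congr taylor; apply/funext => Z.
    rewrite aut_mapE /linfrac linfrac_denE mxE mulrC; congr (_ / _).
    by rewrite mxE /affine add0r; apply: eq_bigr => i _; rewrite mulrC.
  rewrite [in RHS]qE taylor_affine_frac ?oner_eq0 //.
  elim/split_N: k => [j|].
    rewrite qz [LHS](fps_affineP (F2^~ j)) F0; congr (affine_fps 0 _); apply/funext => i.
    elim/split_N: i => [i|].
      by rewrite /aut_mx block_mxEul -/lam lamU mxE.
    by rewrite /aut_mx block_mxEdl -/lam scalemxAr lamU aL mxE.
  rewrite qw /affine_fps scale0r add0r (bigD1 wi) //= big1 ?addr0.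
    by rewrite /aut_mx block_mxEdr mxE eqxx mulr1n -/lam -cE.
  elim/split_N => [i _|]; last by rewrite eqxx.
  by rewrite /aut_mx block_mxEur mxE scale0r.
have autT : aut_hyperquadric l (aut_map l lambda r a sigma U).
  exact: (aut_hyperquadric_aut_map r a lam_gt0 sigmaE U_unit U_isom).
exists lambda, r, a, sigma, U; split; first exact: (And4 lam_gt0 sigmaE U_unit U_isom).
have sigV : sigma^-1 = sigma by case: sigmaE => ->; rewrite ?invrN invr1.
have cV : sigma * lam ^- 2 = c^-1 by rewrite cE [RHS]invfM sigV.
apply: (And3 autT HT); rewrite qT -HT -/lam cV; exact: A1E.
Qed.

End EquivalenceData.

(** * The theorem *)

Section Equivalence.
Variables (R : realType) (n l : nat).
Local Notation C := R[i].
Local Notation N := (n + 1)%N.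
Local Notation wi := (@wi n).

(** Otherwise a column of the Jacobian of H would vanish. *)
Lemma formally_invertible_normal (H : 'rV[fps C N]_N) : formally_invertible H ->
  exists i, H 0 wi (mnm1 i) != 0.
Proof.
move=> [H0 [G [G0 _ GH]]]; apply: contrapT => Hn.
have /matrixP/(_ wi wi) := jacobian0_comp H G0.
rewrite GH jacobian0_vars !mxE eqxx big1 => [/eqP|k _]; first by rewrite oner_eq0.
rewrite [X in _ * X]mxE; have [->|Hk] := eqVneq (H 0 wi (mnm1 k)) 0; first by rewrite mulr0.
by case: Hn; exists k.
Qed.

(** Only the first-order part of T matters: the inverse series comes from the
    formal inverse function theorem, with no comparison with the Taylor series of
    the inverse germ. *)
Lemma formally_invertible_taylor_map (T : 'rV[C]_N -> 'rV[C]_N) :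
  local_biholomorphism T -> formally_invertible (taylor_map T).
Proof.
move=> bT; have T0 := taylor_map_nct (let: And3 T0 _ _ := bT in T0).
split=> //; have [G [G0 GT TG]] := formal_inverse T0 (local_biholomorphism_jacobian bT).
by exists G.
Qed.

End Equivalence.

Theorem theorem1p3 (R : realType) (n l k1 k2 : nat)
  (n_ge1 : (1 <= n)%N) (l_le_n2 : (2 * l <= n)%N) (k_lt_n : (k1 + k2 < n)%N)
  (A1 A2 : fps R[i] ((n + 1) + (n + 1)))
  (A1_H : Hclass k1 A1) (A2_H : Hclass k2 A2) :
  (formally_equivalent (fdefining l A1) (fdefining l A2) <->
   exists T : 'rV[R[i]]_(n + 1) -> 'rV[R[i]]_(n + 1),
     aut_hyperquadric l T /\
     sends (taylor_map T) (fdefining l A1) (fdefining l A2))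
  /\
  (forall H : 'rV[fps R[i] (n + 1)]_(n + 1),
     formal_equivalence H (fdefining l A1) (fdefining l A2) ->
     exists (lambda r : R) (a : 'rV[R[i]]_n) (sigma : R[i]) (U : 'M[R[i]]_n),
       let T := aut_map l lambda r a sigma U in
       let q := holo (taylor (aut_den l r a)) in
       [/\ 0 < lambda,
           sigma = 1 \/ sigma = -1,
           U \in unitmx &
           forall z : 'rV[R[i]]_n,
             lform l (z *m U) (map_mx Num.conj z *m map_mx Num.conj U)
             = sigma * lform l z (map_mx Num.conj z)] /\
       [/\ aut_hyperquadric l T,
           H = taylor_map T &
           A1 = (sigma * (lambda%:C)%C ^- 2) *:
                  (q * fps_conj q * comp_bar A2 (taylor_map T))]).
Proof.
have rigid (H : 'rV[fps R[i] (n + 1)]_(n + 1)) :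
    formal_equivalence H (fdefining l A1) (fdefining l A2) -> exists c q F,
    linear_fractional l A1 A2 H c q F.
  move=> [invH sendsH].
  exact: (sends_linear_fractional k_lt_n A1_H A2_H invH.1 (formally_invertible_normal invH) sendsH).
split; last by move=> H /rigid[c [q [F lf]]]; exact: lf_aut_map lf.
split=> [[H HE]|[T [autT sendsT]]].
  have [c [q [F lf]]] := rigid H HE.
  have [lambda [r [a [sigma [U [_ [autT HT _]]]]]]] := lf_aut_map lf.
  by exists (aut_map l lambda r a sigma U); split=> //; rewrite -HT; case: HE.
exists (taylor_map T); split=> //; exact: formally_invertible_taylor_map autT.1.
Qed.
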